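(* Let $E$ and $F$ be graphs of Gelfand-Kirillov dimension three in normal form, and let $A_E$ and $A_F$ be the adjacency matrices of $E$ and $F$, respectively. Then $A_E$ and $A_F$ are strong shift equivalent if and only if $E\approx F$.
   Context: A graph $E=(E^0,E^1,r,s)$ consists of a vertex set, an edge set and source and range maps $s,r:E^1\to E^0$. A finite graph is essential if every vertex emits an edge and receives an edge. The adjacency matrix is $A_E(v,w)=|s^{-1}(v)\cap r^{-1}(w)|$. Square nonnegative integer matrices $A,B$ are elementary shift equivalent if $A=RS$, $B=SR$ for some nonnegative integer matrices $R,S$; they are strong shift equivalent if they are joined by a finite sequence of elementary shift equivalences. A path is a string $e_1\cdots e_n$ of edges with $r(e_i)=s(e_{i+1})$; a cycle is a closed path of positive length $e_1\cdots e_n$ with $s(e_1),\dots,s(e_n)$ distinct (considered up to choice of base vertex). A graph of Gelfand-Kirillov dimension three is a connected finite essential graph whose Leavitt path algebra $L_K(E)$ has Gelfand-Kirillov dimension $3$ (independent of the field $K$); equivalently, $E$ is a connected finite essential graph consisting of pairwise disjoint cycles $C_1^E,\dots,C_m^E$ (the source cycles) and $D_1^E,\dots,D_n^E$ (the sink cycles), $m,n\ge1$, which are all the cycles of $E$, together with paths leading from source cycles to sink cycles; no edge enters a source cycle from outside it, no edge leaves a sink cycle, and every vertex not on a cycle lies on a path from some source cycle to some sink cycle. A trail is a path $p=e_1\cdots e_t$ with $s(p)$ on a source cycle, $r(p)$ on a sink cycle, and $r(e_k)$ on none of the source or sink cycles for $1\le k<t$. $E$ is in normal form if every trail consists of exactly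 one edge and, for each source cycle, all trails starting from it have the same source; denote by $v_i^E$ the common source of the trails starting from $C_i^E$. Let $p_i^E=|C_i^E|$, $q_j^E=|D_j^E|$ (lengths), $d_{(i,j)}^E=\gcd(p_i^E,q_j^E)$. The vertices of each cycle of length $\ell$ are indexed consecutively along the direction of the edges by the integers $1,\dots,\ell$ (read modulo $\ell$). For an integer $c$, $N_{(i,j)}^E(c)$ is the number of trails of $E$ starting at $v_i^E$ and ending at a vertex of $D_j^E$ whose index $l$ satisfies $l\equiv c \pmod{d_{(i,j)}^E}$. For graphs $E,F$ of Gelfand-Kirillov dimension three in normal form, $E\approx F$ means that $E$ and $F$ have the same number $m$ of source cycles and the same number $n$ of sink cycles, and that for suitable numberings $C_1^E,\dots,C_m^E$, $D_1^E,\dots,D_n^E$ and $C_1^F,\dots,C_m^F$, $D_1^F,\dots,D_n^F$ of these cycles there are integers $a_1,\dots,a_m,b_1,\dots,b_n$ such that $p_i^E=p_i^F$, $q_j^E=q_j^F$ and $N_{(i,j)}^E(c)=N_{(i,j)}^F(c+a_i+b_j)$ for all $c\in\mathbb{N}$, $1\le i\le m$, $1\le j\le n$. *)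

(* Defs.v *)
From mathcomp Require Import all_boot all_order all_algebra.
Set Implicit Arguments.
Unset Strict Implicit.
Unset Printing Implicit Defensive.

Record graph := Graph {
  vert : finType;
  edge : finType;
  src : edge -> vert;
  rng : edge -> vert
}.

Definition adjacency (E : graph) : 'M[nat]_#|vert E| :=
  \matrix_(i, j) #|[set e : edge E | (src e == enum_val i) &&
                                     (rng e == enum_val j)]|.

Definition elem_shift_equiv m n (A : 'M[nat]_m) (B : 'M[nat]_n) : Prop :=
  exists (R : 'M[nat]_(m, n)) (S : 'M[nat]_(n, m)),
    A = (R *m S)%R /\ B = (S *m R)%R.

Inductive strong_shift_equiv :
    forall m n, 'M[nat]_m -> 'M[nat]_n -> Prop :=
| sse_refl m (A : 'M[nat]_m) : strong_shift_equiv A A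
| sse_step m n k (A : 'M[nat]_m) (B : 'M[nat]_n) (C : 'M[nat]_k) :
    elem_shift_equiv A B -> strong_shift_equiv B C -> strong_shift_equiv A C.

Section Graphs.
Variable E : graph.
Implicit Types (e f : edge E) (c d p q : seq (edge E)) (v w : vert E).

Definition essential : Prop :=
  forall v, (exists e, src e = v) /\ (exists e, rng e = v).

Definition adjacent : rel (vert E) := fun v w =>
  [exists e, ((src e == v) && (rng e == w)) || ((src e == w) && (rng e == v))].

Definition connected : Prop := forall v w, connect adjacent v w.

Definition composable : rel (edge E) := fun e f => rng e == src f.

(* A path of positive length is given by its first edge [e] and the sequence
   [p] of the remaining ones, with [path composable e p]. *)
Definition path_vertices e p : seq (vert E) := src e :: map (@rng E) (e :: p).

(* A cycle with a chosen base vertex; the same cycle with another base vertex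
   is [rot k c]. *)
Definition is_cycle c : bool :=
  [&& c != [::], cycle composable c & uniq (map (@src E) c)].

Definition cycle_vertices c : seq (vert E) := map (@src E) c.

Definition same_cycle c d : Prop := exists k, d = rot k c.

Definition source_cycle c : bool :=
  is_cycle c &&
  [forall e, (rng e \in cycle_vertices c) ==> (src e \in cycle_vertices c)].

Definition sink_cycle c : bool :=
  is_cycle c &&
  [forall e, (src e \in cycle_vertices c) ==> (rng e \in cycle_vertices c)].

Definition on_source_cycle v : Prop :=
  exists2 c, source_cycle c & v \in cycle_vertices c.

Definition on_sink_cycle v : Prop :=
  exists2 c, sink_cycle c & v \in cycle_vertices c.

Definition on_cycle v : Prop :=
  exists2 c, is_cycle c & v \in cycle_vertices c.

(* Graphs of Gelfand-Kirillov dimension three, by the graph-theoretic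
   description equivalent to the Leavitt path algebra of [E] having
   Gelfand-Kirillov dimension 3. The exclusive or is needed: source and sink
   cycles are disjoint, so a single isolated cycle does not qualify. *)
Definition gk_dim3 : Prop :=
  [/\ essential /\ connected,
      (exists c, source_cycle c) /\ (exists d, sink_cycle d),
      forall c d, is_cycle c -> is_cycle d ->
        same_cycle c d \/ ~~ has (mem (cycle_vertices c)) (cycle_vertices d),
      forall c, is_cycle c -> source_cycle c (+) sink_cycle c &
      forall v, ~ on_cycle v ->
        exists e p, [/\ path composable e p, on_source_cycle (src e),
                        on_sink_cycle (rng (last e p)) &
                        v \in path_vertices e p]].

(* [belast e p] is the path [e :: p] without its last edge. *)
Definition is_trail e p : Prop :=
  [/\ path composable e p, on_source_cycle (src e),
      on_sink_cycle (rng (last e p)) &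
      forall f, f \in belast e p ->
        ~ on_source_cycle (rng f) /\ ~ on_sink_cycle (rng f)].

Definition normal_form : Prop :=
  (forall e p, is_trail e p -> size (e :: p) = 1) /\
  (forall c, source_cycle c -> forall e p f q,
     is_trail e p -> src e \in cycle_vertices c ->
     is_trail f q -> src f \in cycle_vertices c -> src e = src f).

(* [v] is the common source of the trails starting from [c]. *)
Definition trail_source c v : Prop :=
  (exists e p, [/\ is_trail e p, src e \in cycle_vertices c & src e = v]) /\
  (forall e p, is_trail e p -> src e \in cycle_vertices c -> src e = v).

Definition vertex_indexing (ix : vert E -> nat) : Prop :=
  forall c, is_cycle c ->
    exists k, map ix (cycle_vertices (rot k c)) = iota 1 (size c).

(* [C] lists the source cycles, without repetition up to
   the choice of the base vertex. *)
Definition source_numbering m (C : 'I_m -> seq (edge E)) : Prop :=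
  (forall i, source_cycle (C i)) /\
  (forall c, source_cycle c -> exists! i, same_cycle (C i) c).

Definition sink_numbering n (D : 'I_n -> seq (edge E)) : Prop :=
  (forall j, sink_cycle (D j)) /\
  (forall d, sink_cycle d -> exists! j, same_cycle (D j) d).

(* For [v] on the source cycle [c] and [d] a sink cycle, the number of trails
   from [v] to a vertex of [d] with index congruent to [x] modulo the gcd of
   the two lengths. In normal form trails are single edges, and every edge
   from a source cycle to a sink cycle is a trail. *)
Definition trail_count (ix : vert E -> nat) c v d (x : int) : nat :=
  #|[set e : edge E | [&& src e == v, rng e \in cycle_vertices d &
       ((ix (rng e))%:Z == x %[mod (gcdn (size c) (size d))%:Z])%Z]]|.

End Graphs.

Definition graph_approx (E F : graph)
    (ixE : vert E -> nat) (ixF : vert F -> nat) : Prop :=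
  exists m n
    (CE : 'I_m -> seq (edge E)) (DE : 'I_n -> seq (edge E))
    (CF : 'I_m -> seq (edge F)) (DF : 'I_n -> seq (edge F))
    (vE : 'I_m -> vert E) (vF : 'I_m -> vert F)
    (a : 'I_m -> int) (b : 'I_n -> int),
  [/\ source_numbering CE /\ sink_numbering DE,
      source_numbering CF /\ sink_numbering DF,
      forall i, trail_source (CE i) (vE i) /\ trail_source (CF i) (vF i),
      (forall i, size (CE i) = size (CF i)) /\
      (forall j, size (DE j) = size (DF j)) &
      forall (x : nat) (i : 'I_m) (j : 'I_n),
        trail_count ixE (CE i) (vE i) (DE j) x%:Z =
        trail_count ixF (CF i) (vF i) (DF j) (x%:Z + a i + b j)%R].

(* Main.v *)
Require Import Defs.
From mathcomp Require Import all_boot all_order all_algebra.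
From mathcomp Require Import zify.
From Stdlib Require Import Classical.

(* In normal form every vertex lies on exactly one cycle, so the adjacency
   matrix is P + X, with P the permutation matrix of the successor map sg along
   the cycles and X counting the edges from source cycles to sink cycles.  The
   invariant is the family of sums of X over the orbits of (sg, sg) on pairs of
   vertices: by Bezout, the orbits in C_i x D_j are the gcd(p_i, q_j) residue
   classes, and the orbit sums are the numbers N_(i,j)(c).

   If T is a matrix unit from a source to a sink vertex, then
   P + Z + TP = (1 + T)(P + Z) and P + Z + PT = (P + Z)(1 + T) are elementary
   shift equivalent, so an edge can be moved along its orbit, and equal orbit
   sums give strong shift equivalence.

   Conversely a strong shift equivalence gives nonnegative R, S with AR = RB,
   SA = BS, RS = A^l and SR = B^l.  Such an R vanishes from sinks to sources, and
   its diagonal blocks are those of a bijection f commuting with the successor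
   maps; the remaining block T of R satisfies
   T(sg u, w) + X(u, w) = T(u, sg^-1 w) + Y(f u, f w), and summing over an
   orbit cancels T. *)

Set Implicit Arguments.
Unset Strict Implicit.
Unset Printing Implicit Defensive.

(** * Matrices over finite types *)

Definition mat_of (V W : finType) (F : V -> W -> nat) : 'M[nat]_(#|V|, #|W|) :=
  \matrix_(i, j) F (enum_val i) (enum_val j).

Definition entry (V W : finType) (M : 'M[nat]_(#|V|, #|W|)) (v : V) (w : W) :=
  M (enum_rank v) (enum_rank w).

Lemma entry_mat_of (V W : finType) (F : V -> W -> nat) : entry (mat_of F) =2 F.
Proof. by move=> v w; rewrite /entry mxE !enum_rankK. Qed.

Lemma mat_ofP (V W : finType) (M N : 'M[nat]_(#|V|, #|W|)) :
  entry M =2 entry N -> M = N.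
Proof.
by move=> eqMN; apply/matrixP => i j; move: (eqMN (enum_val i) (enum_val j));
  rewrite /entry !enum_valK.
Qed.

Lemma entryM (U V W : finType) (M : 'M[nat]_(#|U|, #|V|))
    (N : 'M[nat]_(#|V|, #|W|)) u w :
  entry (M *m N)%R u w = \sum_v entry M u v * entry N v w.
Proof.
rewrite /entry mxE (reindex (@enum_rank V)) //=.
by exists enum_val => i _; rewrite ?enum_rankK ?enum_valK.
Qed.

Lemma entry1 (V : finType) (v w : V) : entry (1%:M)%R v w = (v == w).
Proof. by rewrite /entry mxE (inj_eq enum_rank_inj); case: eqP. Qed.

Lemma entryM_gt0 (U V W : finType) (M : 'M[nat]_(#|U|, #|V|))
    (N : 'M[nat]_(#|V|, #|W|)) u v w :
  0 < entry M u v -> 0 < entry N v w -> 0 < entry (M *m N)%R u w.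
Proof.
by move=> Muv Nvw; rewrite entryM (bigD1 v) //= addn_gt0 muln_gt0 Muv Nvw.
Qed.

Lemma sum_delta_l (V : finType) (v : V) (F : V -> nat) :
  \sum_w (v == w) * F w = F v.
Proof.
rewrite (bigD1 v) //= eqxx mul1n big1 ?addn0 // => w /negPf.
by rewrite eq_sym => ->; rewrite mul0n.
Qed.

Lemma sum_delta_r (V W : finType) (f : V -> W) (g : W -> V) (w : W)
    (F : V -> nat) : cancel f g -> cancel g f ->
  \sum_v F v * (f v == w) = F (g w).
Proof.
move=> fK gK; rewrite (bigD1 (g w)) //= gK eqxx muln1 big1 ?addn0 // => v.
by rewrite -(inj_eq (can_inj fK)) gK => /negPf->; rewrite muln0.
Qed.

(** * Strong shift equivalence and shift equivalence *)

Lemma ese_sym m n (A : 'M[nat]_m) (B : 'M[nat]_n) :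
  elem_shift_equiv A B -> elem_shift_equiv B A.
Proof. by case=> R [S [eqA eqB]]; exists S, R. Qed.

Lemma sse_ese m n (A : 'M[nat]_m) (B : 'M[nat]_n) :
  elem_shift_equiv A B -> strong_shift_equiv A B.
Proof. by move/sse_step; apply; apply: sse_refl. Qed.

Lemma sse_trans m n k (A : 'M[nat]_m) (B : 'M[nat]_n) (C : 'M[nat]_k) :
  strong_shift_equiv A B -> strong_shift_equiv B C -> strong_shift_equiv A C.
Proof. by elim=> // {}m {}n j {}A {}B D eAB _ IH /IH; apply: sse_step. Qed.

(** The factors of successive steps are composed, each step raising the lag [l] by one; the empty
    chain has lag zero and identity matrices. *)
Lemma sse_shift_equiv m n (A : 'M[nat]_m) (B : 'M[nat]_n) :
  strong_shift_equiv A B ->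
  exists l (R : 'M[nat]_(m, n)) (S : 'M[nat]_(n, m)),
    [/\ A *m R = R *m B, S *m A = B *m S,
        R *m S = (A : 'M_m) ^+ l & S *m R = (B : 'M_n) ^+ l]%R.
Proof.
have powSr k (M : 'M[nat]_k) j : (M ^+ j.+1 = M ^+ j *m M)%R.
  exact: GRing.exprSr.
elim=> {m n A B} [m A | m n k A B C [R0 [S0 [eqA eqB]]] _ [l [R [S]]]].
  by exists 0, (1%:M)%R, (1%:M)%R; split; rewrite ?mulmx1 ?mul1mx ?GRing.expr0.
case=> BR SB RS SR; exists l.+1, (R0 *m R)%R, (S *m S0)%R.
have AR0 : (A *m R0 = R0 *m B)%R by rewrite eqA eqB mulmxA.
have S0A : (S0 *m A = B *m S0)%R by rewrite eqA eqB mulmxA.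
(* Intertwining passes to powers; this carries [R *m S], which is a power of [B], across [R0]. *)
have R0B j : (R0 *m B ^+ j = A ^+ j *m R0)%R.
  elim: j => [|j IH]; first by rewrite !GRing.expr0 mulmx1 mul1mx.
  by rewrite !powSr mulmxA IH -mulmxA -AR0 mulmxA.
split.
- by rewrite mulmxA AR0 -!mulmxA BR.
- by rewrite -mulmxA S0A !mulmxA SB.
- by rewrite mulmxA -(mulmxA R0) RS R0B -mulmxA -eqA powSr.
- by rewrite mulmxA -(mulmxA S) -eqB SB -mulmxA SR; symmetry; apply: GRing.exprS.
Qed.

(** * Moving edges along orbits *)

Definition diag (V : Type) (sg : V -> V) (z : V * V) := (sg z.1, sg z.2).

Lemma diag_inj (V : Type) (sg : V -> V) : injective sg -> injective (diag sg).
Proof. by move=> sgI [u w] [u' w'] [/sgI-> /sgI->]. Qed.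

Lemma iter_diag (V : Type) (sg : V -> V) k z :
  iter k (diag sg) z = (iter k sg z.1, iter k sg z.2).
Proof. by elim: k => [|k /= ->] //; case: z. Qed.

Lemma iter_inj (V : Type) (sg : V -> V) k : injective sg -> injective (iter k sg).
Proof. by move=> sgI; elim: k => [|k IH] // u w /= /sgI /IH. Qed.

Lemma iter_invariant (V T : Type) (sg : V -> V) (s : V -> T) k v :
  (forall u, s (sg u) = s u) -> s (iter k sg v) = s v.
Proof. by move=> sgs; elim: k => //= k <-. Qed.

Lemma iter_morph (V W : Type) (sg : V -> V) (ta : W -> W) (f : V -> W) k v :
  (forall u, f (sg u) = ta (f u)) -> f (iter k sg v) = iter k ta (f v).
Proof. by move=> fE; elim: k => //= k <-. Qed.

Definition orbit_sum (V : finType) (sg : V -> V) (X : V -> V -> nat) z :=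
  \sum_(y | fconnect (diag sg) z y) X y.1 y.2.

(** With [s] marking the source vertices this is strict block triangularity: two such matrices
    multiply to zero, also with the matrix of an [s]-preserving map between them. *)
Definition supported (V : Type) (s : pred V) (X : V -> V -> nat) :=
  forall u w, ~~ (s u && ~~ s w) -> X u w = 0.

Definition perm_plus (V : finType) (sg : V -> V) (X : V -> V -> nat) :=
  mat_of (fun u w => (sg u == w) + X u w).

Lemma eq_perm_plus (V : finType) (sg : V -> V) (X Y : V -> V -> nat) :
  X =2 Y -> perm_plus sg X = perm_plus sg Y.
Proof. by move=> eqXY; apply: mat_ofP => u w; rewrite !entry_mat_of eqXY. Qed.

Definition addf (V : Type) (X Y : V -> V -> nat) := fun u w => X u w + Y u w.

Definition unit_at (V : eqType) (z : V * V) : V -> V -> nat :=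
  fun u w => ((u, w) == z).

Section Moves.
Variables (V : finType) (sg : V -> V) (s : pred V).
Hypotheses (sgI : injective sg) (sgs : forall v, s (sg v) = s v).
Implicit Types (X Y Z : V -> V -> nat) (z : V * V).

Lemma orbit_sumD X Y z :
  orbit_sum sg (addf X Y) z = orbit_sum sg X z + orbit_sum sg Y z.
Proof. exact: big_split. Qed.

Lemma orbit_sum_unit y z :
  orbit_sum sg (unit_at y) z = fconnect (diag sg) z y.
Proof.
rewrite /orbit_sum /unit_at.
under eq_bigr => x _ do rewrite -surjective_pairing.
case: (boolP (fconnect _ z y)) => zy.
  by rewrite (bigD1 y) //= eqxx big1 // => x /andP[_ /negPf->].
by rewrite big1 // => x zx; case: eqP => // xy; rewrite -xy zx in zy.
Qed.

Lemma orbit_sum_fconnect X y z :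
  fconnect (diag sg) y z -> orbit_sum sg X y = orbit_sum sg X z.
Proof.
move=> yz; apply: eq_bigl => x.
exact: same_connect (fconnect_sym (diag_inj sgI)) _ _ yz x.
Qed.

(* With T the matrix unit at (sg u, w), supported like Z, and P the matrix of
   sg, one has (1 + T)(P + Z) = P + Z + TP and (P + Z)(1 + T) = P + Z + PT. *)
Lemma move_edge Z u w : supported s Z -> s u -> ~~ s w ->
  elem_shift_equiv (perm_plus sg (addf Z (unit_at (sg u, sg w))))
                   (perm_plus sg (addf Z (unit_at (u, w)))).
Proof.
move=> Zs su sw.
exists (mat_of (fun x y => (x == y) + (x == sg u) * (y == w))), (perm_plus sg Z).
split; apply: mat_ofP => x y; rewrite entryM entry_mat_of /addf /unit_at.
  under eq_bigr => v _ do rewrite !entry_mat_of mulnDl.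
  rewrite big_split /= sum_delta_l -addnA; congr (_ + (_ + _)).
  under eq_bigr => v _ do rewrite -mulnA (eq_sym v).
  (* The cross term [T Z] reads row [w] of [Z], which is zero because [w] is not a source vertex. *)
  rewrite -big_distrr /= sum_delta_l Zs; last by rewrite (negPf sw).
  by rewrite addn0 xpair_eqE mulnb (eq_sym y).
under eq_bigr => v _ do rewrite !entry_mat_of mulnDr.
rewrite big_split /=; under eq_bigr => v _ do rewrite mulnC (eq_sym v).
rewrite sum_delta_l -addnA; congr (_ + (_ + _)).
under eq_bigr => v _ do rewrite mulnCA (eq_sym v).
(* The cross term [Z T] reads column [sg u] of [Z], which is zero because [sg u] is a source
   vertex. *)
rewrite sum_delta_l Zs; last by rewrite sgs su andbF.
by rewrite addn0 (inj_eq sgI) xpair_eqE mulnb.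
Qed.

Lemma move_edge_iter Z z k : supported s Z -> s z.1 && ~~ s z.2 ->
  strong_shift_equiv (perm_plus sg (addf Z (unit_at z)))
                     (perm_plus sg (addf Z (unit_at (iter k (diag sg) z)))).
Proof.
move=> Zs /andP[s1 s2]; elim: k => [|k IH]; first exact: sse_refl.
apply: sse_trans IH _; apply/sse_ese/ese_sym.
by rewrite !iter_diag /=; apply: move_edge => //; rewrite (iter_invariant _ _ sgs).
Qed.

Lemma supported_add X Y : supported s X -> supported s Y -> supported s (addf X Y).
Proof. by move=> Xs Ys u w nuw; rewrite /addf Xs ?Ys. Qed.

Lemma supported_gt0 X u w : supported s X -> 0 < X u w -> s u && ~~ s w.
Proof. by move=> Xs Xuw; apply: contraLR Xuw => /Xs->. Qed.

Lemma remove_unit X z : 0 < X z.1 z.2 ->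
  exists2 X', X =2 addf X' (unit_at z) & forall u w, X' u w <= X u w.
Proof.
move=> Xz; exists (fun u w => X u w - unit_at z u w) => u w; last exact: leq_subr.
by rewrite /addf subnK // /unit_at; case: eqP => // zE; rewrite -zE in Xz.
Qed.

Lemma eq_orbit_sum X Y : X =2 Y -> orbit_sum sg X =1 orbit_sum sg Y.
Proof. by move=> XY z; apply: eq_bigr => y _. Qed.

(** Units are matched one at a time: a unit of [X] is moved along its orbit to a position where [Y]
    is positive, then both copies are put into an accumulator [Z]. The induction is on a bound [N]
    for the total of [X]. *)
Lemma sse_of_orbit_sum X Y : supported s X -> supported s Y ->
  orbit_sum sg X =1 orbit_sum sg Y ->
  strong_shift_equiv (perm_plus sg X) (perm_plus sg Y).
Proof.
suff main Z : supported s Z -> supported s X -> supported s Y ->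
    orbit_sum sg X =1 orbit_sum sg Y ->
    strong_shift_equiv (perm_plus sg (addf Z X)) (perm_plus sg (addf Z Y)).
  by move=> Xs Ys XY; apply: (main (fun _ _ => 0)).
move: {2}(\sum_u \sum_w X u w) (leqnn (\sum_u \sum_w X u w)) => N.
elim: N X Y Z => [|N IH] X Y Z.
  rewrite leqn0 sum_nat_eq0 => /forallP /= X0 Zs Xs Ys XY.
  have {}X0 u w : X u w = 0.
    by move: (X0 u); rewrite sum_nat_eq0 => /forallP /(_ w) /eqP.
  suff Y0 u w : Y u w = 0.
    rewrite (@eq_perm_plus _ _ _ (addf Z Y)); first exact: sse_refl.
    by move=> u w; rewrite /addf X0 Y0.
  have := XY (u, w); rewrite [LHS]big1 // => /esym /eqP.
  by rewrite sum_nat_eq0 => /forallP /(_ (u, w)) /=; rewrite connect0 => /eqP.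
move=> leXN Zs Xs Ys XY.
have [[z Xz] | noX] := classic (exists z, 0 < X z.1 z.2); last first.
  apply: IH => //; rewrite big1 // => u _; rewrite big1 // => w _.
  by apply/eqP; rewrite -leqn0 leqNgt; apply/negP => Xuw; case: noX; exists (u, w).
(* Equality of the sums over the orbit of [z] provides a positive entry of [Y] on that orbit. *)
have [y zy Yy] : exists2 y, fconnect (diag sg) z y & 0 < Y y.1 y.2.
  have : 0 < orbit_sum sg Y z.
    by rewrite -XY /orbit_sum (bigD1 z) //= addn_gt0 Xz.
  rewrite lt0n sum_nat_eq0 negb_forall => /existsP[y].
  by rewrite negb_imply -lt0n => /andP[]; exists y.
have [X' XE leX] := remove_unit Xz; have [Y' YE leY] := remove_unit Yy.
have X's : supported s X'.
  by move=> u w /Xs Xuw; apply/eqP; rewrite -leqn0 -Xuw leX.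
have Y's : supported s Y'.
  by move=> u w /Ys Yuw; apply/eqP; rewrite -leqn0 -Yuw leY.
have ys := supported_gt0 Ys Yy; have zs := supported_gt0 Xs Xz.
have us : supported s (unit_at y).
  move=> u w nuw; rewrite /unit_at; case: eqP => // uwy.
  by rewrite -uwy /= (negPf nuw) in ys.
rewrite (@eq_perm_plus _ _ _ (addf (addf Z X') (unit_at z))); last first.
  by move=> u w; rewrite /addf XE /addf addnA.
rewrite (@eq_perm_plus _ _ (addf Z Y) (addf (addf Z (unit_at y)) Y')); last first.
  by move=> u w; rewrite /addf YE /addf addnAC addnA.
apply: sse_trans (move_edge_iter (findex (diag sg) z y) _ zs) _.
  exact: supported_add.
rewrite iter_findex //.
rewrite (@eq_perm_plus _ _ _ (addf (addf Z (unit_at y)) X')); last first.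
  by move=> u w; rewrite /addf addnAC.
apply: IH => //; first 1 last.
- exact: supported_add.
(* The units removed at [z] and [y] lie on the same orbit, so they contribute equally to every orbit
   sum and cancel. *)
- move=> x; apply/eqP; rewrite -(eqn_add2r (orbit_sum sg (unit_at z) x)).
  rewrite -orbit_sumD -(eq_orbit_sum XE) XY (eq_orbit_sum YE) orbit_sumD.
  rewrite !orbit_sum_unit.
  by rewrite (same_connect_r (fconnect_sym (diag_inj sgI)) zy).
- rewrite -ltnS; apply: leq_trans leXN.
  rewrite (bigD1 z.1) //= [X in _ < X](bigD1 z.1) //= -addSn leq_add //.
    rewrite (bigD1 z.2) //= [X in _ < X](bigD1 z.2) //= -addSn leq_add //.
      by rewrite XE /addf /unit_at -surjective_pairing eqxx addn1.
    by apply: leq_sum.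
  by apply: leq_sum => u _; apply: leq_sum.
Qed.

End Moves.

(** With [Q] the permutation matrix of [f] and [B] the right-hand matrix, the factors are [Q] and
    [B Q^-1]. *)
Lemma ese_relabel (V W : finType) (sg : V -> V) (ta : W -> W) (f : V -> W)
    (Y : W -> W -> nat) : bijective f -> (forall v, f (sg v) = ta (f v)) ->
  elem_shift_equiv (perm_plus sg (fun u v => Y (f u) (f v))) (perm_plus ta Y).
Proof.
case=> g fK gK fE.
exists (mat_of (fun v w => (f v == w) : nat)).
exists (mat_of (fun w v => entry (perm_plus ta Y) w (f v))).
split; apply: mat_ofP => v w; rewrite entryM !entry_mat_of.
  under eq_bigr => x _ do rewrite !entry_mat_of.
  by rewrite sum_delta_l -fE (can_eq fK).
under eq_bigr => x _ do rewrite !entry_mat_of.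
by rewrite (sum_delta_r _ _ fK gK) gK.
Qed.

(** * Invariance of the orbit sums *)

(** Every orbit length divides the factorial of the cardinality. The extra factor [k] allows a
    period shared by maps on two different sets. *)
Lemma iter_card_fact (V : finType) (sg : V -> V) k v : injective sg ->
  iter (k * #|V|`!) sg v = v.
Proof.
move=> sgI; have /dvdnP[q ->] : order sg v %| #|V|`!.
  by rewrite dvdn_fact // order_gt0 max_card.
by rewrite mulnA; elim: (k * q) => //= {}k IH; rewrite mulSn iterD IH iter_order.
Qed.

Lemma iter_mod (V : Type) (sg : V -> V) L k v : iter L sg v = v ->
  iter (k %% L) sg v = iter k sg v.
Proof.
move=> sgL; rewrite {2}(divn_eq k L) addnC iterD; congr iter.
by elim: (k %/ L) => // q IH; rewrite mulSn addnC iterD sgL.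
Qed.

(** No cancellation occurs among nonnegative terms, so positive entries of [R] and [S] compose only
    along [a] and [b]. If [h u] is a row in which column [u] of [S] is positive, then row [u] of [R]
    can only be positive at [b (h u)], and its entry there divides 1; thus [f] is [b \o h]. *)
Lemma bijection_of_factors (V W : finType) (R : V -> W -> nat) (S : W -> V -> nat)
    (a : V -> V) (b : W -> W) : injective a -> injective b ->
  (forall u v, \sum_w R u w * S w v = (a u == v)) ->
  (forall w x, \sum_v S w v * R v x = (b w == x)) ->
  exists2 f : V -> W, bijective f & forall u w, R u w = (f u == w).
Proof.
move=> aI bI RS SR.
have gt0_ex (T : finType) (F G : T -> nat) : \sum_x F x * G x = 1 ->
    exists2 x, 0 < F x & 0 < G x.
  move=> FG; have : 0 < \sum_x F x * G x by rewrite FG.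
  rewrite lt0n sum_nat_eq0 negb_forall => /existsP[x].
  by rewrite /= muln_eq0 negb_or -!lt0n => /andP[]; exists x.
have RS_eq u w v : 0 < R u w -> 0 < S w v -> a u = v.
  move=> Ruw Swv; have := RS u v; rewrite (bigD1 w) //=; case: eqP => // _.
  by move/eqP; rewrite addn_eq0 muln_eq0 (gtn_eqF Ruw) (gtn_eqF Swv).
have SR_eq w v x : 0 < S w v -> 0 < R v x -> b w = x.
  move=> Swv Rvx; have := SR w x; rewrite (bigD1 v) //=; case: eqP => // _.
  by move/eqP; rewrite addn_eq0 muln_eq0 (gtn_eqF Swv) (gtn_eqF Rvx).
have [a' aK a'K] := injF_bij aI; have [b' bK b'K] := injF_bij bI.
have /fin_all_exists[h Sh] v : exists w, 0 < S w v.
  have [|w _ Swv] := gt0_ex _ (R (a' v)) (S^~ v); last by exists w.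
  by rewrite RS a'K eqxx.
have Rh u w : 0 < R u w -> b (h u) = w by apply: SR_eq (Sh u).
have R1 u : R u (b (h u)) = 1.
  have [|w Ruw Swv] := gt0_ex _ (R u) (S^~ (a u)); first by rewrite RS eqxx.
  have wE := Rh _ _ Ruw; have := RS u (a u); rewrite eqxx (bigD1 w) //=.
  rewrite big1 => [|x /eqP xw]; last first.
    case: (posnP (R u x)) => [->|/Rh] //; rewrite wE => wx.
    by case: xw.
  by rewrite addn0 wE => /eqP; rewrite muln_eq1 => /andP[/eqP].
have RE u w : R u w = (b (h u) == w).
  case: eqP => [<-|nw]; first by rewrite R1.
  by case: (posnP (R u w)) => // /Rh.
exists (b \o h) => //=.
apply: (bij_comp (injF_bij bI)).
have hI : injective h.
  move=> u v huv; apply: aI; rewrite -(RS_eq u (b (h v)) (a v)) //.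
  - by rewrite -huv R1.
  - have [|w Rvw Swv] := gt0_ex _ (R v) (S^~ (a v)); first by rewrite RS eqxx.
    by rewrite (Rh _ _ Rvw).
have bhI : injective (b \o h) by apply: inj_comp.
have /fin_all_exists[g gE] w : exists v, h v = w.
  have [|v Swv Rvw] := gt0_ex _ (S w) (R^~ (b w)); first by rewrite SR eqxx.
  by exists v; apply: bI; apply: Rh.
by exists g => // v; apply: hI; rewrite gE.
Qed.

(** * Powers of the block triangular matrix [P + X] *)

Section Powers.
Variables (V : finType) (sg : V -> V) (s : pred V) (X : V -> V -> nat).
Hypotheses (sgs : forall v, s (sg v) = s v) (Xs : supported s X).

Lemma perm_plus_exp k : exists2 Xk, supported s Xk &
  forall u w, entry ((perm_plus sg X : 'M_#|V|) ^+ k)%R u w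
              = (iter k sg u == w) + Xk u w.
Proof.
elim: k => [|k [Xk Xks IH]].
  by exists (fun _ _ => 0) => // u w; rewrite GRing.expr0 addn0 -entry1.
(* Expanding [(P^k + Xk)(P + X)], the remainder besides [P^(k+1)] is [P^k X + Xk (P + X)]. *)
exists (fun u w => X (iter k sg u) w + \sum_v Xk u v * ((sg v == w) + X v w)).
  move=> u w nuw; rewrite Xs ?iter_invariant //.
  rewrite big1 // => v _; case: (boolP (s u && ~~ s v)) => [uv | /Xks->//].
  rewrite Xs; last by case/andP: uv => _ /negPf->.
  case: eqP => [vw|]; last by rewrite muln0.
  by rewrite -vw sgs uv in nuw.
move=> u w; rewrite (_ : _ ^+ _ = (perm_plus sg X ^+ k *m perm_plus sg X))%R;
  last exact: GRing.exprSr.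
rewrite entryM; under eq_bigr => v _ do rewrite IH entry_mat_of mulnDl.
by rewrite big_split /= sum_delta_l -addnA; congr (_ + (_ + _)).
Qed.

Lemma perm_plus_exp_gt0 k u :
  0 < entry ((perm_plus sg X : 'M_#|V|) ^+ k)%R u (iter k sg u).
Proof. by have [Xk _ ->] := perm_plus_exp k; rewrite eqxx. Qed.

Hypothesis Xout : forall u, s u -> exists k w, 0 < X (iter k sg u) w.

(** At a period of [sg] the diagonal blocks become identities. A source row of [N] is nonzero
    because a walk of length exactly [L] can follow the cycle to an exit, cross it, and spend the
    remaining steps on the sink side. *)
Lemma perm_plus_period L : 0 < L -> (forall v, iter L sg v = v) ->
  exists N, [/\ supported s N, forall u, s u -> exists w, 0 < N u w &
  forall u w, entry ((perm_plus sg X : 'M_#|V|) ^+ L)%R u w = (u == w) + N u w].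
Proof.
move=> L_gt0 sgL; have [N Ns NE] := perm_plus_exp L.
exists N; split=> // [u su|u w]; last by rewrite NE sgL.
(* Reducing [k] modulo [L] leaves room for the crossing and the last [L - k.+1] steps. *)
have [k [w]] := Xout su; rewrite -(iter_mod k (sgL u)).
have := ltn_pmod k L_gt0; move: (k %% L) => {}k lt_kL Xkw.
have /andP[_ sw] := supported_gt0 Xs Xkw.
exists (iter (L - k.+1) sg w).
suff: 0 < entry ((perm_plus sg X : 'M_#|V|) ^+ L)%R u (iter (L - k.+1) sg w).
  rewrite NE sgL; case: eqP => // uw.
  by rewrite uw iter_invariant // (negPf sw) in su.
have LE : L = k + (1 + (L - k.+1)) by rewrite addnA addn1 subnKC.
have expD i j : ((perm_plus sg X : 'M_#|V|) ^+ (i + j) =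
    perm_plus sg X ^+ i *m perm_plus sg X ^+ j)%R by apply: GRing.exprD.
rewrite {1}LE !expD; apply: entryM_gt0 (perm_plus_exp_gt0 _ _) _.
apply: entryM_gt0 (perm_plus_exp_gt0 _ _).
by rewrite GRing.expr1 entry_mat_of addn_gt0 Xkw orbT.
Qed.

End Powers.

(** * Vanishing of the sink-to-source block of an intertwiner *)

Section Intertwiner.
Variables (V W : finType) (sg : V -> V) (ta : W -> W) (s : pred V) (t : pred W).
Variables (X : V -> V -> nat) (Y : W -> W -> nat).
Hypotheses (sgI : injective sg) (taI : injective ta).
Hypotheses (sgs : forall v, s (sg v) = s v) (tat : forall w, t (ta w) = t w).
Hypotheses (Xs : supported s X) (Yt : supported t Y).
Hypothesis Xout : forall u, s u -> exists k w, 0 < X (iter k sg u) w.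
Hypothesis Yout : forall u, t u -> exists k w, 0 < Y (iter k ta u) w.

(* For a common period L of sg and ta write A^L = 1 + N and B^L = 1 + N', so
   that N R = R N'.  Sink rows of N vanish; source rows of N' do not. *)
Lemma intertwiner_sink_source (R : 'M[nat]_(#|V|, #|W|)) v w :
  (perm_plus sg X *m R = R *m perm_plus ta Y)%R ->
  ~~ s v -> t w -> entry R v w = 0.
Proof.
move=> AR sv tw; pose L := #|W|`! * #|V|`!.
have L_gt0 : 0 < L by rewrite muln_gt0 !fact_gt0.
have sgL u : iter L sg u = u by apply: iter_card_fact.
have taL u : iter L ta u = u by rewrite /L mulnC; apply: iter_card_fact.
have [N [Ns _ NE]] := perm_plus_period sgs Xs Xout L_gt0 sgL.
have [N' [N't N'out N'E]] := perm_plus_period tat Yt Yout L_gt0 taL.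
have ARL : ((perm_plus sg X : 'M_#|V|) ^+ L *m R =
            R *m (perm_plus ta Y : 'M_#|W|) ^+ L)%R.
  elim: L {L_gt0 sgL taL NE N'E} => [|L IH].
    by rewrite !GRing.expr0 mul1mx mulmx1.
  rewrite (_ : perm_plus sg X ^+ _ = perm_plus sg X ^+ L *m perm_plus sg X)%R;
    last exact: GRing.exprSr.
  rewrite (_ : perm_plus ta Y ^+ _ = perm_plus ta Y ^+ L *m perm_plus ta Y)%R;
    last exact: GRing.exprSr.
  by rewrite -mulmxA AR mulmxA IH mulmxA.
have [x N'wx] := N'out _ tw.
have := congr1 (fun M => entry M v x) ARL; rewrite !entryM.
under eq_bigr => u _ do rewrite NE mulnDl.
under [in RHS]eq_bigr => u _ do rewrite N'E mulnDr.
rewrite !big_split /= sum_delta_l (@sum_delta_r _ _ id id) //.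
(* The identity parts cancel and row [v] of [N] is zero, so every term [R v u * N' u x] vanishes, in
   particular the one at [u = w], where [N' w x] is positive. *)
move/eqP; rewrite eqn_add2l big1 => [|u _]; last by rewrite Ns ?mul0n ?(negPf sv).
rewrite eq_sym sum_nat_eq0 => /forallP /(_ w) /=.
by rewrite muln_eq0 [N' _ _ == _]eqn0Ngt N'wx orbF => /eqP.
Qed.

End Intertwiner.

(** * Orbit sums under strong shift equivalence *)

Section Invariants.
Variables (V W : finType) (sg : V -> V) (ta : W -> W) (s : pred V) (t : pred W).
Variables (X : V -> V -> nat) (Y : W -> W -> nat).
Hypotheses (sgI : injective sg) (taI : injective ta).
Hypotheses (sgs : forall v, s (sg v) = s v) (tat : forall w, t (ta w) = t w).
Hypotheses (Xs : supported s X) (Yt : supported t Y).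
Hypothesis Xout : forall u, s u -> exists k w, 0 < X (iter k sg u) w.
Hypothesis Yout : forall u, t u -> exists k w, 0 < Y (iter k ta u) w.

Lemma sse_orbit_sum : strong_shift_equiv (perm_plus sg X) (perm_plus ta Y) ->
  exists f : V -> W, [/\ bijective f, forall v, f (sg v) = ta (f v),
    forall v, t (f v) = s v &
    forall z, orbit_sum sg X z = orbit_sum sg (fun u v => Y (f u) (f v)) z].
Proof.
move/sse_shift_equiv => [l [R [S [AR SA RS SR]]]].
have R0 := intertwiner_sink_source sgI taI sgs tat Xs Yt Xout Yout AR.
have S0 := intertwiner_sink_source taI sgI tat sgs Yt Xs Yout Xout (esym SA).
have [Xl Xls XlE] := perm_plus_exp sgs Xs l.
have [Yl Ylt YlE] := perm_plus_exp tat Yt l.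
(* [Rd] and [Sd] are the block diagonal parts. Since [R] and [S] are block triangular, the products
   of these parts are the diagonal blocks of [R S] and [S R], which are powers of the two
   permutation matrices. *)
pose Rd v w := (s v == t w) * entry R v w.
pose Sd w v := (s v == t w) * entry S w v.
have RSd u v : \sum_w Rd u w * Sd w v = (iter l sg u == v).
  case: (eqVneq (s u) (s v)) => [suv | nsuv]; last first.
    rewrite big1 => [|w _]; last first.
      rewrite /Rd /Sd; case: eqP => [<-|//].
      by rewrite eq_sym (negPf nsuv) muln0.
    by case: eqP => // uv; rewrite -uv iter_invariant // eqxx in nsuv.
  have := congr1 (fun M => entry M u v) RS; rewrite entryM XlE Xls ?addn0; last first.
    by rewrite suv andbN.
  move<-; apply: eq_bigr => w _; rewrite /Rd /Sd suv.
  case: (eqVneq (s v) (t w)) => [_|]; first by rewrite !mul1n.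
  rewrite !mul0n; case: (boolP (t w)) => tw; case: (boolP (s v)) => // sv _.
    by rewrite R0 // suv.
  by rewrite S0 ?muln0.
have SRd w x : \sum_v Sd w v * Rd v x = (iter l ta w == x).
  case: (eqVneq (t w) (t x)) => [twx | ntwx]; last first.
    rewrite big1 => [|v _]; last first.
      rewrite /Rd /Sd; case: eqP => [->|//].
      by rewrite (negPf ntwx) muln0.
    by case: eqP => // wx; rewrite -wx iter_invariant // eqxx in ntwx.
  have := congr1 (fun M => entry M w x) SR; rewrite entryM YlE Ylt ?addn0; last first.
    by rewrite twx andbN.
  move<-; apply: eq_bigr => v _; rewrite /Rd /Sd twx.
  case: (eqVneq (s v) (t x)) => [_|]; first by rewrite !mul1n.
  rewrite !mul0n; case: (boolP (t x)) => tx; case: (boolP (s v)) => // sv _.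
    by rewrite R0 ?muln0.
  by rewrite S0 // twx.
have [f fB RdE] := bijection_of_factors (iter_inj sgI) (iter_inj taI) RSd SRd.
have [g fK gK] := fB.
have [sg' sgK sg'K] := injF_bij sgI; have [ta' taK ta'K] := injF_bij taI.
have ft v : t (f v) = s v.
  apply/eqP; have := RdE v (f v); rewrite eqxx /Rd eq_sym.
  by case: eqP.
have RE v w : s v = t w -> entry R v w = (f v == w).
  by move=> vw; rewrite -RdE /Rd vw eqxx mul1n.
have key v w : entry R (sg v) w + \sum_u X v u * entry R u w =
               entry R v (ta' w) + \sum_x entry R v x * Y x w.
  have := congr1 (fun M => entry M v w) AR; rewrite !entryM.
  under eq_bigr => u _ do rewrite entry_mat_of mulnDl.
  under [in RHS]eq_bigr => u _ do rewrite entry_mat_of mulnDr.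
  by rewrite !big_split /= sum_delta_l (sum_delta_r _ _ taK ta'K).
(* In the column [f (sg v)], which has the type of [v], both off-diagonal sums in [key] vanish,
   leaving [1 = (f v == ta' (f (sg v)))]. *)
have fsg v : f (sg v) = ta (f v).
  have := key v (f (sg v)).
  rewrite RE ?ft // eqxx big1 => [|u _]; last first.
    case: (boolP (s v && ~~ s u)) => [/andP[sv su]|/Xs->//].
    by rewrite R0 ?muln0 // ft sgs.
  rewrite [X in _ = _ + X]big1 => [|x _]; last first.
    case: (boolP (t x && ~~ t (f (sg v)))) => [/andP[tx]|/Yt->]; last exact: muln0.
    by rewrite ft sgs => sv; rewrite R0.
  rewrite !addn0 RE; last by rewrite -(tat (ta' _)) ta'K ft sgs.
  by case: eqP => // ->; rewrite ta'K.
exists f; split=> //.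
pose T u v := entry R u (f v).
(* This is [key] at column [f v]: in each sum the diagonal blocks of [R], now known to be [f],
   select a single term. *)
have cohom u v : s u && ~~ s v ->
    T (sg u) v + X u v = T u (sg' v) + Y (f u) (f v).
  case/andP=> su sv; have := key u (f v).
  have -> : ta' (f v) = f (sg' v) by rewrite -{1}(sg'K v) fsg taK.
  rewrite /T => keyE.
  have <- : \sum_u0 X u u0 * entry R u0 (f v) = X u v.
    rewrite (bigD1 v) //= RE ?ft // eqxx muln1 big1 ?addn0 // => x /negPf xv.
    case: (boolP (s x)) => sx; first by rewrite Xs ?sx ?andbF.
    by rewrite RE ?ft ?(negPf sx) ?(negPf sv) // (can_eq fK) xv muln0.
  rewrite keyE; congr (_ + _).
  rewrite (bigD1 (f u)) //= RE ?ft // eqxx mul1n big1 ?addn0 // => x /negPf xu.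
  case: (boolP (t x)) => tx; last by rewrite Yt ?muln0 // (negPf tx).
  by rewrite RE ?tx ?su // eq_sym xu.
move=> z; case: (boolP (s z.1 && ~~ s z.2)) => zs; last first.
  have orb y : fconnect (diag sg) z y -> s y.1 && ~~ s y.2 = s z.1 && ~~ s z.2.
    move/iter_findex <-; rewrite iter_diag /=.
    by rewrite !(iter_invariant _ _ sgs).
  rewrite /orbit_sum !big1 // => y /orb yz; first by rewrite Yt ?ft ?yz.
  by rewrite Xs ?yz.
(* Adding the sum of [T (sg u) v] to both sides allows [cohom] to be applied termwise; the two sums
   of [T] then agree after reindexing by [diag sg]. *)
apply/eqP; rewrite -(eqn_add2l (\sum_(y | fconnect (diag sg) z y) T (sg y.1) y.2)).
rewrite -big_split /=; apply/eqP.
under eq_bigr => y zy.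
  rewrite cohom; first by over.
  by rewrite -(iter_findex zy) iter_diag /= !(iter_invariant _ _ sgs).
rewrite big_split /=; congr (_ + _).
rewrite (reindex_inj (diag_inj sgI)) /=; apply: eq_big => y.
  by rewrite -same_fconnect1_r //; apply: diag_inj.
by rewrite sgK.
Qed.

End Invariants.

(** * Cycles of graphs in normal form *)

Lemma uniq_map_inj_in (T U : eqType) (f : T -> U) (c : seq T) :
  uniq (map f c) -> {in c &, injective f}.
Proof.
elim: c => //= x c IH /andP[xc /IH{}IH] e e'; rewrite !inE.
have nf e1 : e1 \in c -> f x <> f e1.
  by move=> e1c fx; rewrite fx map_f in xc.
by case: eqP => [->|_]; case: eqP => [->|_] //= ce ce' fe;
  [case: (nf e') | case: (nf e) | apply: IH].
Qed.

Section Cycles.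
Variable E : graph.
Implicit Types (c d : seq (edge E)) (e f : edge E).

Lemma src_next c e : is_cycle c -> e \in c -> src (next c e) = rng e.
Proof. by case/and3P=> _ cc _ ec; have /eqP := next_cycle cc ec. Qed.

Lemma same_cycle_mem c d : same_cycle c d -> c =i d.
Proof. by case=> k -> e; rewrite mem_rot. Qed.

Lemma eq_source_cycle c d : is_cycle c -> is_cycle d ->
  cycle_vertices c =i cycle_vertices d -> source_cycle c = source_cycle d.
Proof.
move=> cc cd eqcd; rewrite /source_cycle cc cd; apply: eq_forallb => e.
by rewrite !eqcd.
Qed.

Lemma source_closed e : on_source_cycle (rng e) -> on_source_cycle (src e).
Proof.
by case=> c cs ce; exists c => //; case/andP: cs => _ /forallP/(_ e)/implyP; apply.
Qed.

Lemma sink_closed e : on_sink_cycle (src e) -> on_sink_cycle (rng e).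
Proof.
by case=> c cs ce; exists c => //; case/andP: cs => _ /forallP/(_ e)/implyP; apply.
Qed.

Lemma sink_closed_path e p : path (@composable E) e p ->
  on_sink_cycle (src e) -> forall v, v \in path_vertices e p -> on_sink_cycle v.
Proof.
elim: p e => [|f p IH] e /=.
  by move=> _ es v; rewrite !inE => /orP[]/eqP->//; apply: sink_closed.
case/andP=> /eqP ef pf es v; rewrite inE => /predU1P[->//|].
by rewrite /= ef => vp; apply: (IH f) => //; rewrite -ef; apply: sink_closed.
Qed.

(** The path is cut at its first arrival on a sink cycle. It never meets a source cycle, since an
    edge ending on one also starts on it. *)
Lemma path_to_sink f p : path (@composable E) f p -> ~ on_source_cycle (src f) ->
  on_sink_cycle (rng (last f p)) ->
  exists q, [/\ path (@composable E) f q, on_sink_cycle (rng (last f q)) &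
    forall g, g \in belast f q -> ~ on_source_cycle (rng g) /\ ~ on_sink_cycle (rng g)].
Proof.
elim: p f => [|g p IH] f /=; first by move=> _ _ fs; exists [::].
case/andP=> fg gp nf ls.
case: (classic (on_sink_cycle (rng f))) => [fs|nfs]; first by exists [::].
have nfg : ~ on_source_cycle (rng f) by move/source_closed.
have [|q [gq lq q_int]] := IH g gp _ ls; first by rewrite -(eqP fg).
exists (g :: q); split=> //=; first by rewrite fg.
by move=> h; rewrite inE => /predU1P[->|/q_int].
Qed.

Hypotheses (EG : gk_dim3 E) (EN : normal_form E).

Lemma same_cycle_of_mem c d v : is_cycle c -> is_cycle d ->
  v \in cycle_vertices c -> v \in cycle_vertices d -> same_cycle c d.
Proof.
case: EG => _ _ sd _ _ cc cd vc vd; case: (sd _ _ cc cd) => // /hasP[].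
by exists v.
Qed.

(** Cycles sharing a vertex are rotations of each other, and the sources along one cycle are
    distinct. This makes the successor of a vertex independent of the cycle chosen through it. *)
Lemma eq_cycle_edge c d e f : is_cycle c -> is_cycle d ->
  e \in c -> f \in d -> src e = src f -> e = f.
Proof.
move=> cc cd ec fd ef.
have ve : src e \in cycle_vertices c by apply: map_f.
have cd' : same_cycle c d.
  by apply: (same_cycle_of_mem cc cd ve); rewrite ef; apply: map_f.
case/and3P: cc => _ _ /uniq_map_inj_in; apply=> //.
by rewrite (same_cycle_mem cd').
Qed.

(* A path from a source cycle to a sink cycle leaves the source cycles along
   an edge starting a trail, and trails have length one. *)
Lemma path_on_cycles e p : path (@composable E) e p ->
  on_source_cycle (src e) -> on_sink_cycle (rng (last e p)) ->
  forall v, v \in path_vertices e p -> on_source_cycle v \/ on_sink_cycle v.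
Proof.
case: EN => NF _; elim: p e => [|f p IH] e /=.
  by move=> _ es ls v; rewrite !inE => /orP[]/eqP->; [left | right].
case/andP=> ef fp es ls v; rewrite inE => /predU1P[->|]; first by left.
move=> vp; have {}vp : v \in path_vertices f p by move: vp; rewrite /= (eqP ef).
case: (classic (on_source_cycle (rng e))) => [fs|nfs].
  by apply: (IH f fp _ ls) vp; rewrite -(eqP ef).
case: (classic (on_sink_cycle (rng e))) => [fs|nfs'].
  by right; apply: (sink_closed_path fp) vp; rewrite -(eqP ef).
have [|q [fq lq q_int]] := path_to_sink fp _ ls; first by rewrite -(eqP ef).
(* Such a trail has at least two edges, contrary to the normal form. *)
suff /NF : is_trail e (f :: q) by [].
split=> //=; first by rewrite ef.
by move=> h; rewrite inE => /predU1P[->|/q_int].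
Qed.

Lemma all_on_cycle (v : vert E) : on_cycle v.
Proof.
case: (classic (on_cycle v)) => // nv; case: EG => _ _ _ _ /(_ v nv).
case=> e [p [ep es ls vp]].
by case: (path_on_cycles ep es ls vp) => -[c /andP[cc _] vc]; exists c.
Qed.

End Cycles.

(** * The successor map along the cycles *)

Definition succ (E : graph) (nx : vert E -> edge E) v := rng (nx v).

(* [nx v] is the edge following [v] on its cycle and [s] marks the vertices of
   the source cycles. *)
Record skeleton (E : graph) (nx : vert E -> edge E) (s : pred (vert E)) : Prop :=
  Skeleton {
  sk_src : forall v, src (nx v) = v;
  sk_inj : injective (succ nx);
  sk_cycle : forall c e, is_cycle c -> e \in c -> e = nx (src e);
  sk_same : forall (c d : seq (edge E)) v, is_cycle c -> is_cycle d ->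
    v \in cycle_vertices c -> v \in cycle_vertices d -> same_cycle c d;
  sk_orbit : forall v, is_cycle (map nx (orbit (succ nx) v));
  sk_s : forall v, s (succ nx v) = s v;
  sk_source : forall c v, is_cycle c -> v \in cycle_vertices c ->
    source_cycle c = s v;
  sk_sink : forall c v, is_cycle c -> v \in cycle_vertices c ->
    sink_cycle c = ~~ s v;
  sk_edge : forall e, e != nx (src e) -> s (src e) && ~~ s (rng e);
  sk_out : forall v, s v ->
    exists2 e, fconnect (succ nx) v (src e) & e != nx (src e)
}.

Lemma cycle_vertices_map (E : graph) (nx : vert E -> edge E) p :
  (forall v, src (nx v) = v) -> cycle_vertices (map nx p) = p.
Proof. by move=> sK; rewrite /cycle_vertices mapK. Qed.

(** Taken with [e = f], this closes an edge to a cycle by following [succ nx] from its range back to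
    its source; [f] is kept separate for the induction. *)
Lemma path_traject (E : graph) (nx : vert E -> edge E) k e f :
  (forall v, src (nx v) = v) -> iter k (succ nx) (rng f) = src e ->
  path (@composable E) f (rcons (map nx (traject (succ nx) (rng f) k)) e).
Proof.
move=> sK; elim: k f => [|k IH] f; first by rewrite /= /composable => ->; rewrite eqxx.
by rewrite iterSr /= {1}/composable sK eqxx => /(IH (nx (rng f))).
Qed.

(** Each vertex gets a chosen cycle through it: [nx] is the edge leaving the vertex on that cycle,
    and [s] tells whether the cycle is a source cycle. *)
Lemma skeleton_exists (E : graph) : gk_dim3 E -> normal_form E ->
  exists nx s, @skeleton E nx s.
Proof.
move=> EG EN.
have /fin_all_exists[g gP] v : exists g : edge E * seq (edge E),
    [/\ src g.1 = v, is_cycle g.2 & g.1 \in g.2].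
  have [c cc /mapP[e ec ->]] := all_on_cycle EG EN v.
  by exists (e, c).
pose nx v := (g v).1; pose s v := source_cycle (g v).2.
have sK v : src (nx v) = v by case: (gP v).
have nxE c e : is_cycle c -> e \in c -> e = nx (src e).
  move=> cc ec; case: (gP (src e)) => eE cg eg.
  by apply: (eq_cycle_edge EG cc cg).
have same_src (c d : seq (edge E)) v : is_cycle c -> is_cycle d ->
    v \in cycle_vertices c -> v \in cycle_vertices d ->
    cycle_vertices c =i cycle_vertices d.
  move=> cc cd vc vd; have cdE := same_cycle_of_mem EG cc cd vc vd.
  exact: eq_mem_map (same_cycle_mem cdE).
have gv v : v \in cycle_vertices (g v).2.
  by case: (gP v) => vE _ /(map_f (@src E)); rewrite vE.
have sucg v : succ nx v \in cycle_vertices (g v).2.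
  case: (gP v) => _ cg vg; rewrite /succ -(src_next cg vg).
  by apply: map_f; rewrite mem_next.
(* Vertices with a common successor lie on one cycle up to rotation, where [next] is injective. *)
have sucI : injective (succ nx).
  move=> v w vw; case: (gP v) (gP w) => _ cv ev [_ cw ew].
  have [k gw] : same_cycle (g v).2 (g w).2.
    by apply: (same_cycle_of_mem EG cv cw (sucg v)); rewrite vw.
  have Uv : uniq (g v).2 by case/and3P: cv => _ _ /map_uniq.
  suff: nx v = nx w by move/(congr1 (@src E)); rewrite !sK.
  apply: (can_inj (prev_next Uv)); apply: (eq_cycle_edge EG cv cv).
  - by rewrite mem_next.
  - by rewrite mem_next -(mem_rot k) -gw.
  rewrite (src_next cv ev) (_ : rng (nx v) = rng (nx w)) // -(src_next cw ew) gw.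
  by rewrite next_rot.
have orbc v : is_cycle (map nx (orbit (succ nx) v)).
  apply/and3P; split.
  - by rewrite -size_eq0 size_map size_orbit -lt0n order_gt0.
  - rewrite cycle_map (eq_cycle (_ : _ =2 frel (succ nx))) ?cycle_orbit //.
    by move=> x y; rewrite /= /composable sK.
  - by rewrite -/(cycle_vertices _) cycle_vertices_map ?orbit_uniq.
have sP c v : is_cycle c -> v \in cycle_vertices c -> source_cycle c = s v.
  move=> cc vc; case: (gP v) => _ cg vg; apply: eq_source_cycle => //.
  exact: (same_src _ _ v).
have tP c v : is_cycle c -> v \in cycle_vertices c -> sink_cycle c = ~~ s v.
  case: EG => _ _ _ xorc _ cc vc; move: (xorc c cc); rewrite (sP c v) //.
  by case: (s v) => //= /negPf.
have ss v : s (succ nx v) = s v.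
  case: (gP v) => _ cg vg; rewrite -(sP _ v cg (gv v)).
  by rewrite -(sP _ (succ nx v) cg).
have sk_fc v w : fconnect (succ nx) v w -> s w = s v.
  by move/iter_findex<-; apply: iter_invariant.
have orbv v : v \in cycle_vertices (map nx (orbit (succ nx) v)).
  by rewrite cycle_vertices_map // in_orbit.
have edge_orbit e : fconnect (succ nx) (rng e) (src e) -> e = nx (src e).
  move=> es; pose k := findex (succ nx) (rng e) (src e).
  have kE : iter k (succ nx) (rng e) = src e by apply: iter_findex.
  have ltk : k < order (succ nx) (rng e) by apply: findex_max.
  apply: (nxE (e :: map nx (traject (succ nx) (rng e) k))); last exact: mem_head.
  apply/and3P; split=> //; first exact: path_traject.
  have U : uniq (traject (succ nx) (rng e) k.+1).
    by rewrite -(take_traject _ _ ltk) take_uniq // orbit_uniq.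
  by rewrite -/(cycle_vertices _) /= cycle_vertices_map // -kE -rcons_uniq -trajectSr.
exists nx, s; split=> //.
    exact: same_cycle_of_mem.
  (* If [e] started on a sink cycle or ended on a source cycle, it would have both ends on that
     cycle, and [edge_orbit] would make it the chosen edge. *)
  move=> e ne.
  have [se|se] := boolP (s (src e)); last first.
    have := tP _ _ (orbc (src e)) (orbv (src e)); rewrite se.
    case/andP=> _ /forallP/(_ e); rewrite orbv cycle_vertices_map //=.
    rewrite -fconnect_orbit fconnect_sym // => /edge_orbit eE.
    by rewrite -eE eqxx in ne.
  apply/negP => re; have := sP _ _ (orbc (rng e)) (orbv (rng e)); rewrite re.
  case/andP=> _ /forallP/(_ e); rewrite orbv cycle_vertices_map //=.
  rewrite -fconnect_orbit => /edge_orbit eE.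
  by rewrite -eE eqxx in ne.
(* If only chosen edges left the orbit of [v], no edge would join it to its complement, as none
   enters a source cycle. Connectedness would then place a vertex of a sink cycle in this orbit. *)
move=> v sv.
suff /existsP[e /andP[]] : [exists e, fconnect (succ nx) v (src e) &&
    (e != nx (src e))] by exists e.
apply: contraT; rewrite negb_exists => /forallP none.
have E1 e : fconnect (succ nx) v (src e) = fconnect (succ nx) v (rng e).
  apply/idP/idP => ve.
    have := none e; rewrite ve negbK => /eqP eE.
    by rewrite eE; apply: connect_trans ve (fconnect1 _ _).
  have := sP _ _ (orbc (rng e)) (orbv (rng e)); rewrite (sk_fc _ _ ve) sv.
  case/andP=> _ /forallP/(_ e); rewrite orbv cycle_vertices_map //=.
  rewrite -fconnect_orbit; exact: connect_trans.
have [[_ conn] [_ [d dd]] _ _ _] := EG.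
have [w wd] : exists w, w \in cycle_vertices d.
  case/andP: dd => /and3P[]; case: (d) => // e d' _ _ _ _.
  by exists (src e); rewrite mem_head.
have cl : closed (@adjacent E) (fconnect (succ nx) v).
  move=> x y /existsP[e /orP[] /andP[/eqP<- /eqP<-]]; last symmetry; exact: E1.
have := closed_connect cl (conn v w); rewrite [LHS]connect0 => /esym /sk_fc.
case/andP: (dd) => cd _; have := tP d w cd wd; rewrite dd sv => /esym/negPf-> //.
Qed.

(** * Orbits and arithmetic of residues *)

Lemma iter_eq_mod (T : finType) (f : T -> T) x k l : injective f ->
  (iter k f x == iter l f x) = (k == l %[mod order f x]).
Proof.
move=> fI.
rewrite -(iter_mod k (iter_order fI x)) -(iter_mod l (iter_order fI x)).
apply/eqP/eqP => [|->//].
by move/(congr1 (findex f x)); rewrite !findex_iter // ltn_pmod ?order_gt0.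
Qed.

(** [r] and [r'] are transversals of the orbits. Sending the [k]-th iterate of [r i] to that of
    [r' i] is well defined because the orbit lengths agree, and the same construction with the roles
    exchanged gives the inverse. *)
Lemma equivariant_bijection (V W : finType) (I : Type) (sg : V -> V) (ta : W -> W)
    (r : I -> V) (r' : I -> W) : injective sg -> injective ta ->
  (forall v, exists i k, v = iter k sg (r i)) ->
  (forall i j k, r i = iter k sg (r j) -> i = j) ->
  (forall w, exists i k, w = iter k ta (r' i)) ->
  (forall i j k, r' i = iter k ta (r' j) -> i = j) ->
  (forall i, order sg (r i) = order ta (r' i)) ->
  exists f : V -> W, bijective f /\
    forall i k, f (iter k sg (r i)) = iter k ta (r' i).
Proof.
move=> sgI taI cov dis cov' dis' ord.
have half (A B : finType) (al : A -> A) (be : B -> B) (a : I -> A) (b : I -> B) :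
    injective al -> injective be ->
    (forall v, exists i k, v = iter k al (a i)) ->
    (forall i j k, a i = iter k al (a j) -> i = j) ->
    (forall i, order al (a i) = order be (b i)) ->
    exists f : A -> B, forall i k, f (iter k al (a i)) = iter k be (b i).
  move=> alI beI cova disa orda.
  have /fin_all_exists[h hE] v : exists ik : I * nat, v = iter ik.2 al (a ik.1).
    by have [i [k ->]] := cova v; exists (i, k).
  exists (fun v => iter (h v).2 be (b (h v).1)) => i k.
  have := hE (iter k al (a i)); move: (h _) => [j l] /= kl.
  have ij : i = j.
    have fc : fconnect al (iter k al (a i)) (a i).
      by rewrite fconnect_sym // fconnect_iter.
    apply: (disa i j (findex al (iter k al (a i)) (a i) + l)).
    by rewrite iterD -kl iter_findex.
  move: kl; rewrite -{}ij => /esym/eqP; rewrite iter_eq_mod // orda => kl.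
  by apply/eqP; rewrite iter_eq_mod.
have [f fE] := half V W sg ta r r' sgI taI cov dis ord.
have [g gE] := half W V ta sg r' r taI sgI cov' dis' (fun i => esym (ord i)).
exists f; split=> //; exists g => [v | w].
  by have [i [k ->]] := cov v; rewrite fE gE.
by have [i [k ->]] := cov' w; rewrite gE fE.
Qed.

(** It supplies a number of steps that fixes a vertex on a cycle of length [p] while acting as [m]
    steps on a cycle of length [q]. *)
Lemma bezout_mod p q m : 0 < p -> gcdn p q %| m ->
  exists2 k, p %| k & k = m %[mod q].
Proof.
move=> p_gt0 /dvdnP[t ->]; case: (egcdnP q p_gt0) => a b ab _.
exists (a * p * t); first by rewrite dvdn_mulr // dvdn_mull.
by rewrite ab mulnDl mulnAC modnMDl mulnC.
Qed.

Lemma nat_residue q (a : int) : 0 < q -> exists k : nat, (k%:Z == a %[mod q%:Z])%Z.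
Proof.
move=> q_gt0; exists (`|(a %% q%:Z)%Z|%N); rewrite gez0_abs.
  by rewrite modz_mod.
by rewrite modz_ge0 // -lt0n.
Qed.

(** * Adjacency matrix, trails and indices in terms of the successor map *)

Section Graph.
Variables (E : graph) (nx : vert E -> edge E) (s : pred (vert E)).
Implicit Types (c d : seq (edge E)) (u v w : vert E).
Hypothesis sk : skeleton nx s.
Local Notation sg := (succ nx).
Let sgI : injective sg := sk_inj sk.
Let sgs : forall v, s (sg v) = s v := sk_s sk.

(** This is the matrix [X] of the decomposition [P + X]. *)
Definition transit u w :=
  #|[set e : edge E | [&& src e == u, rng e == w & e != nx (src e)]]|.

Lemma adjacencyE : adjacency E = perm_plus sg transit.
Proof.
apply: mat_ofP => u w; rewrite entry_mat_of /entry mxE !enum_rankK.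
rewrite (cardsD1 (nx u)) inE (sk_src sk) eqxx; congr (_ + _).
apply: eq_card => e; rewrite !inE andbC -!andbA; case: eqP => //= ->.
by rewrite andbC.
Qed.

Lemma transitP u w : reflect
  (exists e, [/\ src e = u, rng e = w & e != nx (src e)]) (0 < transit u w).
Proof.
apply: (iffP card_gt0P) => [[e]|[e [eu ew ne]]].
  by rewrite inE => /and3P[/eqP ? /eqP ? ?]; exists e.
by exists e; rewrite inE eu ew !eqxx /= -eu.
Qed.

Lemma transit_supported : supported s transit.
Proof.
move=> u w nuw; apply/eqP; rewrite -leqn0 leqNgt; apply/transitP => -[e [eu ew]].
by move/(sk_edge sk); rewrite eu ew (negPf nuw).
Qed.

Lemma transit_out u : s u -> exists k w, 0 < transit (iter k sg u) w.
Proof.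
move=> /(sk_out sk)[e ue ne]; exists (findex sg u (src e)), (rng e).
by rewrite iter_findex //; apply/transitP; exists e.
Qed.

Lemma s_fconnect v w : fconnect sg v w -> s w = s v.
Proof. by move/iter_findex<-; apply: iter_invariant. Qed.

Lemma mem_orbit_cycle (v : vert E) : v \in cycle_vertices (map nx (orbit sg v)).
Proof. by rewrite cycle_vertices_map ?in_orbit //; apply: sk_src sk. Qed.

Lemma fcycle_cycle_vertices c : is_cycle c -> fcycle sg (cycle_vertices c).
Proof.
move=> cc; case/and3P: (cc) => _ + _; rewrite cycle_map.
apply: (sub_in_cycle (P := [in c])) => [e f ec _ /eqP|]; last exact/allP.
by rewrite /= /succ -(sk_cycle sk cc ec) => ->.
Qed.

Lemma fconnect_cycle_vertices c v w : is_cycle c -> v \in cycle_vertices c ->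
  fconnect sg v w = (w \in cycle_vertices c).
Proof. by move=> cc vc; apply: fconnect_cycle => //; apply: fcycle_cycle_vertices. Qed.

Lemma order_cycle_vertices c v : is_cycle c -> v \in cycle_vertices c ->
  order sg v = size c.
Proof.
move=> cc vc; rewrite (order_cycle (fcycle_cycle_vertices cc)) ?size_map //.
by case/and3P: cc.
Qed.

Lemma edge_is_trail e : e != nx (src e) -> is_trail e [::].
Proof.
move/(sk_edge sk)/andP => [se re]; split=> //.
  exists (map nx (orbit sg (src e))); last exact: mem_orbit_cycle.
  by rewrite (sk_source sk (sk_orbit sk _) (mem_orbit_cycle _)).
exists (map nx (orbit sg (rng e))); last exact: mem_orbit_cycle.
by rewrite (sk_sink sk (sk_orbit sk _) (mem_orbit_cycle _)).
Qed.

Lemma trail_source_mem c v : trail_source c v -> v \in cycle_vertices c.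
Proof. by case=> -[e [p [_ ec <-]]] _. Qed.

(** It confines an orbit sum over pairs from [c] to a sink cycle to the single row [v]. *)
Lemma trail_source_transit c v u w : is_cycle c -> trail_source c v ->
  fconnect sg v u -> 0 < transit u w -> u = v.
Proof.
move=> cc tv; rewrite (fconnect_cycle_vertices _ cc (trail_source_mem tv)) => uc.
case/transitP=> e [eu _ /edge_is_trail te]; case: tv => _ /(_ e [::] te).
by rewrite eu; apply.
Qed.

Lemma trail_source_exists v : normal_form E -> s v ->
  exists u, trail_source (map nx (orbit sg v)) u.
Proof.
move=> [_ NF] sv; have [e ve ne] := sk_out sk sv.
have te := edge_is_trail ne.
have ec : src e \in cycle_vertices (map nx (orbit sg v)).
  by rewrite -(fconnect_cycle_vertices _ (sk_orbit sk v) (mem_orbit_cycle v)).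
have cs : source_cycle (map nx (orbit sg v)).
  by rewrite (sk_source sk (sk_orbit sk v) (mem_orbit_cycle v)).
exists (src e); split; first by exists e, [::].
by move=> f q tf fc; apply: (NF _ cs f q e [::]).
Qed.

(** Up to rotation the indices along the orbit read [1, ..., q], so a step adds one except for the
    drop from [q] to 1. *)
Lemma index_iter ix k v : vertex_indexing ix ->
  ix (iter k sg v) = ix v + k %[mod order sg v].
Proof.
move=> /(_ _ (sk_orbit sk v)) [j]; rewrite /cycle_vertices map_rot.
rewrite -/(cycle_vertices _) cycle_vertices_map; last exact: sk_src sk.
rewrite size_map size_orbit => ixE; set q := order sg v in ixE *.
have q_gt0 : 0 < q by apply: order_gt0.
have : fcycle sg (rot j (orbit sg v)) by rewrite rot_cycle; apply: cycle_orbit.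
have vo : v \in rot j (orbit sg v) by rewrite mem_rot in_orbit.
have oq : size (rot j (orbit sg v)) = q by rewrite size_rot size_orbit.
have uo : uniq (rot j (orbit sg v)) by rewrite rot_uniq orbit_uniq.
case: (rot _ _) ixE vo oq uo => [|x p] // ixE vo oq uo fc.
have xpE := fcycle_consE fc; rewrite -[(size p).+1]/(size (x :: p)) oq in xpE.
have qx : iter q sg x = x.
  by rewrite -oq -(order_cycle fc uo (mem_head x p)) iter_order.
(* Here [x] is the vertex of index 1, hence the successor on the residue. *)
have ix_x k' : ix (iter k' sg x) = (k' %% q).+1.
  have k'q := ltn_pmod k' q_gt0; rewrite -(iter_mod k' qx).
  rewrite -[iter _ sg x](nth_traject sg k'q) -xpE -(nth_map x 0) ?oq //.
  by rewrite ixE nth_iota.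
move: vo; rewrite xpE => /trajectP[i iq ->].
by rewrite -iterD !ix_x -!(addn1 (_ %% _)) -addnA !modnDml
  addnCA [in RHS]addnC (addnC i).
Qed.

End Graph.

(** * Trail counts and numberings of cycles *)

Lemma iter_eq_id (T : finType) (f : T -> T) x k : injective f ->
  (iter k f x == x) = (order f x %| k).
Proof. by move=> fI; rewrite (iter_eq_mod x k 0 fI) mod0n. Qed.

Section Counts.
Variables (E : graph) (nx : vert E -> edge E) (s : pred (vert E)).
Implicit Types (c d : seq (edge E)) (u v w : vert E).
Hypothesis sk : skeleton nx s.
Local Notation sg := (succ nx).
Let sgI : injective sg := sk_inj sk.

(** An iterate fixing [v] is a multiple of [size c], so it changes the index on [d] by a multiple of
    the gcd; [bezout_mod] gives the converse. *)
Lemma fconnect_diag_gcd ix c d v w y : vertex_indexing ix ->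
  is_cycle c -> is_cycle d -> v \in cycle_vertices c -> w \in cycle_vertices d ->
  fconnect (diag sg) (v, w) (v, y) =
  (y \in cycle_vertices d) && (ix y == ix w %[mod gcdn (size c) (size d)]).
Proof.
move=> hix cc cd vc wd; set g := gcdn _ _.
have oc := order_cycle_vertices sk cc vc; have od := order_cycle_vertices sk cd wd.
have c_gt0 : 0 < size c by rewrite -oc order_gt0.
have ixk k : ix (iter k sg w) = ix w + k %[mod size d].
  by rewrite -od; apply: (index_iter sk).
have ixg k : ix (iter k sg w) = ix w + k %[mod g].
  by rewrite -(modn_dvdm _ (dvdn_gcdr _ _)) ixk modn_dvdm ?dvdn_gcdr.
apply/idP/andP => [/iter_findex | [yd]].
  rewrite iter_diag => -[vk <-]; move: (findex _ _ _) vk => k vk.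
  split; first by rewrite -(fconnect_cycle_vertices sk _ cd wd) fconnect_iter.
  have /dvdnP[t kt] : g %| k.
    apply: dvdn_trans (dvdn_gcdl _ _) _.
    by rewrite -oc -iter_eq_id //; apply/eqP.
  by rewrite ixg kt addnC modnMDl.
rewrite -(fconnect_cycle_vertices sk _ cd wd) in yd.
rewrite -(iter_findex yd) ixg; move: (findex _ _ _) => m.
rewrite -[X in _ == X %[mod _]]addn0 eqn_modDl mod0n => gm.
have [k ck km] := bezout_mod c_gt0 gm.
have -> : (v, iter m sg w) = iter k (diag sg) (v, w).
  rewrite iter_diag; congr pair; apply/esym/eqP; first by rewrite iter_eq_id // oc.
  by rewrite iter_eq_mod // od km.
exact: fconnect_iter.
Qed.

(** Trails are grouped by their end [y]: the admissible ends are those with [(v, y)] on the orbit of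
    [(v, w)], and [only_v] removes all other rows of that orbit. *)
Lemma trail_count_orbit_sum ix c d v w x : vertex_indexing ix ->
  is_cycle c -> is_cycle d -> v \in cycle_vertices c -> w \in cycle_vertices d ->
  s v -> ~~ s w ->
  (forall u y, fconnect sg v u -> 0 < transit nx u y -> u = v) ->
  ((ix w)%:Z == x %[mod (gcdn (size c) (size d))%:Z])%Z ->
  trail_count ix c v d x = orbit_sum sg (transit nx) (v, w).
Proof.
move=> hix cc cd vc wd sv sw only_v /eqP wx.
transitivity (\sum_(y | fconnect (diag sg) (v, w) (v, y)) transit nx v y).
  rewrite /trail_count -sum1_card (partition_big (@rng E)
    (fun y => fconnect (diag sg) (v, w) (v, y))) => [|e]; last first.
    rewrite inE (fconnect_diag_gcd _ hix cc cd vc wd) => /and3P[_ -> /=].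
    by rewrite -wx !modz_nat.
  apply: eq_bigr => y vy; rewrite sum1_card; apply: eq_card => e.
  rewrite !inE unfold_in /= inE.
  case: (eqVneq (src e) v) => //= eu; case: (eqVneq (rng e) y) => [ey|_]; last first.
    by rewrite andbF.
  move: vy; rewrite (fconnect_diag_gcd _ hix cc cd vc wd) ey => /andP[yd yw].
  (* [trail_count] does not exclude the cycle edge [nx v] explicitly, but that edge stays on a
     source cycle and cannot end on [d]. *)
  rewrite yd -wx !modz_nat eqz_nat yw /=; apply/esym; apply: contraNneq sw => eE.
  have sy : s y by rewrite -ey eE (sk_s sk) eu.
  by rewrite (s_fconnect sk (_ : fconnect sg y w)) //
    (fconnect_cycle_vertices sk _ cd yd).
have pairE P F : \sum_(z : vert E * vert E | P z) F z.1 z.2 =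
    \sum_u \sum_(y | P (u, y)) F u y :> nat.
  by rewrite pair_big_dep; apply: eq_bigl => -[].
rewrite /orbit_sum pairE [RHS](bigD1 v) //= [X in _ + X]big1 ?addn0 // => u uv.
apply: big1 => y vuy; apply/eqP; rewrite -leqn0 leqNgt; apply/negP => uy.
case/eqP: uv; apply: only_v uy; move/iter_findex: vuy.
by rewrite iter_diag => -[<- _]; apply: fconnect_iter.
Qed.

End Counts.

Lemma cycle_vertex_exists (E : graph) (c : seq (edge E)) :
  is_cycle c -> exists v, v \in cycle_vertices c.
Proof. by case: c => // e c _; exists (src e); rewrite mem_head. Qed.

(** [source_numbering] and [sink_numbering] are instances up to conversion, so one set of lemmas
    serves both. *)
Definition numbering (E : graph) (P : pred (seq (edge E))) m
    (C : 'I_m -> seq (edge E)) : Prop :=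
  (forall i, P (C i)) /\ (forall c, P c -> exists! i, same_cycle (C i) c).

Section Numberings.
Variables (E : graph) (nx : vert E -> edge E) (s : pred (vert E)).
Hypothesis sk : skeleton nx s.
Local Notation sg := (succ nx).
Let sgI : injective sg := sk_inj sk.

Variables (P : pred (seq (edge E))) (t : pred (vert E)).
Hypothesis P_cycle : forall c, P c -> is_cycle c.
Hypothesis Pt : forall c v, is_cycle c -> v \in cycle_vertices c -> P c = t v.

Section FromNumbering.
Variables (m : nat) (C : 'I_m -> seq (edge E)) (r : 'I_m -> vert E).
Hypotheses (CN : numbering P C) (rC : forall i, r i \in cycle_vertices (C i)).

Lemma numbering_cover v : t v -> exists i k, v = iter k sg (r i).
Proof.
move=> tv; have vc := mem_orbit_cycle sk v; have cc := sk_orbit sk v.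
have Pc : P (map nx (orbit sg v)) by rewrite (Pt cc vc).
have [PC /(_ _ Pc) [i [iv _]]] := CN; exists i, (findex sg (r i) v).
rewrite iter_findex // (fconnect_cycle_vertices sk _ (P_cycle (PC i)) (rC i)).
by rewrite (eq_mem_map _ (same_cycle_mem iv)).
Qed.

Lemma numbering_disjoint i j k : r i = iter k sg (r j) -> i = j.
Proof.
move=> ij; have [PC /(_ _ (PC j)) [l [_ lU]]] := CN.
have ri : r i \in cycle_vertices (C j).
  by rewrite -(fconnect_cycle_vertices sk _ (P_cycle (PC j)) (rC j)) ij fconnect_iter.
rewrite -(lU i) ?(lU j) //; first by exists 0; rewrite rot0.
exact: (sk_same sk (P_cycle (PC i)) (P_cycle (PC j)) (rC i)).
Qed.

End FromNumbering.

Lemma numbering_of_transversal m (r : 'I_m -> vert E) :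
  (forall i, t (r i)) -> (forall v, t v -> exists i k, v = iter k sg (r i)) ->
  (forall i j k, r i = iter k sg (r j) -> i = j) ->
  numbering P (fun i => map nx (orbit sg (r i))).
Proof.
move=> tr cov dis.
have vc v := mem_orbit_cycle sk v; have cc v := sk_orbit sk v.
split=> [i|c Pc]; first by rewrite (Pt (cc _) (vc _)).
have [v vC] := cycle_vertex_exists (P_cycle Pc).
have tv : t v by rewrite -(Pt (P_cycle Pc) vC).
have [i [k vE]] := cov v tv; exists i; split=> [|j jc].
  apply: (sk_same sk (cc _) (P_cycle Pc) _ vC).
  by rewrite -(fconnect_cycle_vertices sk _ (cc _) (vc _)) vE fconnect_iter.
apply: (dis i j (findex sg (r j) (r i))).
rewrite iter_findex // (fconnect_cycle_vertices sk _ (cc _) (vc _)).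
rewrite (eq_mem_map _ (same_cycle_mem jc)).
rewrite -(fconnect_cycle_vertices sk _ (P_cycle Pc) vC).
by rewrite fconnect_sym // vE fconnect_iter.
Qed.

End Numberings.

(** The canonical roots [froot sg v] of the orbits inside [t] are enumerated. *)
Lemma transversal_exists (V : finType) (sg : V -> V) (t : pred V) :
  injective sg -> (forall v, t (sg v) = t v) ->
  exists m (r : 'I_m -> V), [/\ forall i, t (r i),
    forall v, t v -> exists i k, v = iter k sg (r i) &
    forall i j k, r i = iter k sg (r j) -> i = j].
Proof.
move=> sgI sgt; pose A := [set v | t v && (froot sg v == v)].
have sym := fconnect_sym sgI.
exists #|A|, enum_val; split=> [i|v tv|i j k].
- by have := enum_valP i; rewrite inE => /andP[].
- have rv : fconnect sg (froot sg v) v by rewrite sym connect_root.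
  have rA : froot sg v \in A.
    rewrite inE root_root // eqxx andbT.
    by rewrite -(iter_findex (connect_root (frel sg) v)) iter_invariant.
  exists (enum_rank_in rA (froot sg v)), (findex sg (froot sg v) v).
  by rewrite enum_rankK_in // iter_findex.
move=> ij; have fij : fconnect sg (enum_val j) (enum_val i).
  by rewrite ij fconnect_iter.
have := enum_valP i; have := enum_valP j; rewrite !inE.
move=> /andP[_ /eqP jr] /andP[_ /eqP ir].
by apply: enum_val_inj; rewrite -ir -jr; apply/eqP; rewrite root_connect // sym.
Qed.

Lemma order_equivariant (V W : finType) (sg : V -> V) (ta : W -> W) (f : V -> W) v :
  injective sg -> injective ta -> injective f -> (forall u, f (sg u) = ta (f u)) ->
  order ta (f v) = order sg v.
Proof.
move=> sgI taI fI fE; apply/eqP; rewrite eqn_dvd -!iter_eq_id //.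
rewrite -(iter_morph _ _ fE) iter_order // eqxx /=.
by rewrite -(inj_eq fI) (iter_morph _ _ fE) iter_order.
Qed.

Lemma orbit_sum_relabel (V W : finType) (sg : V -> V) (ta : W -> W) (f : V -> W)
    (Y : W -> W -> nat) z : bijective f -> (forall v, f (sg v) = ta (f v)) ->
  orbit_sum sg (fun u v => Y (f u) (f v)) z = orbit_sum ta Y (f z.1, f z.2).
Proof.
move=> [g fK gK] fE; rewrite /orbit_sum.
pose F (y : V * V) := (f y.1, f y.2).
have FI : injective F by move=> [a b] [a' b'] [/(can_inj fK)-> /(can_inj fK)->].
have FE y : F (diag sg y) = diag ta (F y) by rewrite /F /= !fE.
rewrite [RHS](reindex F) /=; last first.
  by exists (fun y => (g y.1, g y.2)) => -[a b] _; rewrite /F /= ?fK ?gK.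
apply: eq_bigl => y; apply/idP/idP => /iter_findex.
  by move=> <-; rewrite (iter_morph _ _ FE); apply: fconnect_iter.
rewrite -/(F z) -(iter_morph _ _ FE) => /FI <-; exact: fconnect_iter.
Qed.

Lemma orbit_sum_iter (V : finType) (sg : V -> V) X k u w : injective sg ->
  orbit_sum sg X (iter k sg u, iter k sg w) = orbit_sum sg X (u, w).
Proof.
move=> sgI; apply: esym; apply: orbit_sum_fconnect => //.
by rewrite -[X in fconnect _ _ X](iter_diag sg k (u, w)) fconnect_iter.
Qed.

(** It turns [index_iter], a congruence of naturals modulo a cycle length, into the integer
    congruence modulo the gcd required by [trail_count_orbit_sum]. *)
Lemma eqmod_dvd_int (m n q g : nat) (x : int) : m = n %[mod q] -> g %| q ->
  (g%:Z %| (n%:Z - x)%R)%Z -> (m%:Z == x %[mod g%:Z])%Z.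
Proof.
move=> mn gq nx; have : m = n %[mod g] by rewrite -(modn_dvdm m gq) mn modn_dvdm.
by move=> mng; rewrite modz_nat mng -modz_nat eqz_mod_dvd.
Qed.

(** * From strong shift equivalence to [graph_approx] *)

Section Forward.
Variables (E F : graph) (nx : vert E -> edge E) (ny : vert F -> edge F).
Variables (s : pred (vert E)) (t : pred (vert F)).
Hypotheses (skE : skeleton nx s) (skF : skeleton ny t).
Local Notation sg := (succ nx).
Local Notation ta := (succ ny).

Lemma approx_of_sse (ixE : vert E -> nat) (ixF : vert F -> nat) :
  normal_form E -> normal_form F ->
  vertex_indexing ixE -> vertex_indexing ixF ->
  strong_shift_equiv (adjacency E) (adjacency F) -> graph_approx ixE ixF.
Proof.
move=> EN FN hE hF; rewrite (adjacencyE skE) (adjacencyE skF).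
have sgI := sk_inj skE; have taI := sk_inj skF.
have ss := sk_s skE; have tt := sk_s skF.
case/(sse_orbit_sum sgI taI ss tt (transit_supported skE) (transit_supported skF)
  (transit_out skE) (transit_out skF)) => f [fB fE ft XY].
have fI := bij_inj fB; have [g fK gK] := fB.
have sss v : ~~ s (sg v) = ~~ s v by rewrite ss.
have [m [r [rs rcov rdis]]] := transversal_exists sgI ss.
have [n [r' [r's r'cov r'dis]]] := transversal_exists sgI sss.
have fcov (p : pred (vert E)) (q : pred (vert F)) k (a : 'I_k -> vert E) :
    (forall v, q (f v) = p v) ->
    (forall v, p v -> exists i l, v = iter l sg (a i)) ->
    forall w, q w -> exists i l, w = iter l ta (f (a i)).
  move=> qf cov w qw; have [|i [l gw]] := cov (g w); first by rewrite -qf gK.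
  by exists i, l; rewrite -(iter_morph _ _ fE) -gw gK.
have fdis k (a : 'I_k -> vert E) : (forall i j l, a i = iter l sg (a j) -> i = j) ->
    forall i j l, f (a i) = iter l ta (f (a j)) -> i = j.
  by move=> dis i j l; rewrite -(iter_morph _ _ fE) => /fI /dis.
have fts v : ~~ t (f v) = ~~ s v by rewrite ft.
have [vE vEP] := fin_all_exists (fun i => trail_source_exists skE EN (rs i)).
have fr i : t (f (r i)) by rewrite ft.
have [vF vFP] := fin_all_exists (fun i => trail_source_exists skF FN (fr i)).
have rvE i : fconnect sg (r i) (vE i).
  rewrite (fconnect_cycle_vertices skE _ (sk_orbit skE (r i)) (mem_orbit_cycle skE _)).
  exact: trail_source_mem (vEP i).
have rvF i : fconnect ta (f (r i)) (vF i).
  rewrite (fconnect_cycle_vertices skF _ (sk_orbit skF _) (mem_orbit_cycle skF _)).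
  exact: trail_source_mem (vFP i).
have vEF i : fconnect ta (f (vE i)) (vF i).
  apply: connect_trans (rvF i); rewrite (fconnect_sym taI).
  by rewrite -(iter_findex (rvE i)) (iter_morph _ _ fE) fconnect_iter.
exists m, n, (fun i => map nx (orbit sg (r i))), (fun j => map nx (orbit sg (r' j))).
exists (fun i => map ny (orbit ta (f (r i)))), (fun j => map ny (orbit ta (f (r' j)))).
(* The bijection [f] need not respect trail sources or indices: [a i] counts the steps from
   [f (vE i)] to [vF i], and [b j] is the change of index at the representative [r' j]. *)
exists vE, vF, (fun i => Posz (findex ta (f (vE i)) (vF i))).
exists (fun j => (Posz (ixF (f (r' j))) - Posz (ixE (r' j)))%R).
split=> //.
- split.
    by apply: (numbering_of_transversal skE _ (sk_source skE)) => // c /andP[].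
  by apply: (numbering_of_transversal skE (t := predC s) _ (sk_sink skE)) =>
    // c /andP[].
- split.
    apply: (numbering_of_transversal skF _ (sk_source skF)) => //.
    + by move=> c /andP[].
    + exact: fcov rcov.
    + exact: fdis rdis.
  apply: (numbering_of_transversal skF (t := predC t) _ (sk_sink skF)) => //.
  + by move=> c /andP[].
  + by move=> j; rewrite /= fts.
  + exact: fcov r'cov.
  + exact: fdis r'dis.
- by split=> i; rewrite !size_map !size_orbit (order_equivariant _ sgI taI fI fE).
move=> x i j; set al := findex _ _ _; set q := order sg (r' j).
have q_gt0 : 0 < q by apply: order_gt0.
have oq : order ta (f (r' j)) = q by apply: order_equivariant.
(* [k] is congruent to [x - ixE (r' j)] modulo [q] without natural subtraction, so the [k]-th
   iterate of [r' j] has index [x] modulo [q]. *)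
pose k := x + q.-1 * ixE (r' j).
have kE : ixE (r' j) + k = x + q * ixE (r' j).
  by rewrite /k addnCA -mulSn prednK.
have valE : iter al ta (f (vE i)) = vF i by apply: iter_findex.
have cE v := sk_orbit skE v; have cF v := sk_orbit skF v.
have mE v := mem_orbit_cycle skE v; have mF v := mem_orbit_cycle skF v.
rewrite (trail_count_orbit_sum skE (v := vE i) (w := iter k sg (r' j)) hE) //.
(* After transport by [f], rotating the pair by [al] brings its first component to [vF i]. *)
- rewrite XY (orbit_sum_relabel _ _ fB fE) /= -(orbit_sum_iter _ al _ _ taI) valE.
  rewrite -(iter_morph _ _ fE) -iterD (iter_morph _ _ fE).
  rewrite (trail_count_orbit_sum skF (v := vF i) (w := iter (al + k) ta (f (r' j))) hF) //.
  + exact: trail_source_mem (vFP i).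
  + by rewrite -(fconnect_cycle_vertices skF _ (cF _) (mF _)) fconnect_iter.
  + by rewrite (s_fconnect skF (rvF i)).
  + by rewrite iter_invariant // fts.
  + by move=> u y; apply: (trail_source_transit skF (cF _) (vFP i)).
  apply: eqmod_dvd_int (index_iter skF (al + k) (f (r' j)) hF) _ _.
    by rewrite !size_map !size_orbit dvdn_gcdr.
  rewrite !size_map !size_orbit oq.
  apply: dvdz_trans (_ : (q%:Z %| _)%Z).
    by rewrite dvdzE /= dvdn_gcdr.
  apply/dvdzP; exists (Posz (ixE (r' j))); lia.
- exact: trail_source_mem (vEP i).
- by rewrite -(fconnect_cycle_vertices skE _ (cE _) (mE _)) fconnect_iter.
- by rewrite (s_fconnect skE (rvE i)).
- by rewrite iter_invariant.
- by move=> u y; apply: (trail_source_transit skE (cE _) (vEP i)).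
apply: eqmod_dvd_int (index_iter skE k (r' j) hE) _ _.
  by rewrite !size_map !size_orbit dvdn_gcdr.
rewrite !size_map !size_orbit kE.
apply: dvdz_trans (_ : (q%:Z %| _)%Z); first by rewrite dvdzE /= dvdn_gcdr.
apply/dvdzP; exists (Posz (ixE (r' j))); lia.
Qed.

End Forward.

(** * One transversal from the source and sink cycles together *)

Definition sum_elim (A B T : Type) (a : A -> T) (b : B -> T) (x : A + B) :=
  match x with inl i => a i | inr j => b j end.

Section Transversal.
Variables (E : graph) (nx : vert E -> edge E) (s : pred (vert E)).
Hypothesis sk : skeleton nx s.
Local Notation sg := (succ nx).
Variables (m n : nat) (C : 'I_m -> seq (edge E)) (D : 'I_n -> seq (edge E)).
Variables (a : 'I_m -> vert E) (b : 'I_n -> vert E).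
Hypotheses (CN : source_numbering C) (DN : sink_numbering D).
Hypotheses (aC : forall i, a i \in cycle_vertices (C i)).
Hypotheses (bD : forall j, b j \in cycle_vertices (D j)).

Let source_is_cycle (c : seq (edge E)) : source_cycle c -> is_cycle c.
Proof. by case/andP. Qed.

Let sink_is_cycle (c : seq (edge E)) : sink_cycle c -> is_cycle c.
Proof. by case/andP. Qed.

Lemma source_cover v : s v -> exists i k, v = iter k sg (a i).
Proof. exact: (numbering_cover sk source_is_cycle (sk_source sk) CN aC). Qed.

Lemma sink_cover v : ~~ s v -> exists j k, v = iter k sg (b j).
Proof. exact: (numbering_cover sk (t := predC s) sink_is_cycle (sk_sink sk) DN bD). Qed.

Lemma source_numbering_s i : s (a i).
Proof.
have [PC _] := CN.
by rewrite -(sk_source sk (source_is_cycle (PC i)) (aC i)).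
Qed.

Lemma sink_numbering_s j : ~~ s (b j).
Proof.
have [PD _] := DN.
by rewrite -(sk_sink sk (sink_is_cycle (PD j)) (bD j)).
Qed.

Lemma sum_cover v : exists x k, v = iter k sg (sum_elim a b x).
Proof.
have [/source_cover|/sink_cover] := boolP (s v) => -[i [k ->]].
  by exists (inl i), k.
by exists (inr i), k.
Qed.

Lemma sum_disjoint x y k :
  sum_elim a b x = iter k sg (sum_elim a b y) -> x = y.
Proof.
have it u : s (iter k sg u) = s u by apply: iter_invariant; apply: sk_s sk.
case: x y => [i|j] [i'|j'] /= xy.
- by rewrite (numbering_disjoint sk source_is_cycle CN aC xy).
- by have := sink_numbering_s j'; rewrite -(it (b j')) -xy source_numbering_s.
- by have := sink_numbering_s j; rewrite xy it source_numbering_s.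
- by rewrite (numbering_disjoint sk sink_is_cycle DN bD xy).
Qed.

End Transversal.

(** * From [graph_approx] to strong shift equivalence *)

Section Backward.
Variables (E F : graph) (nx : vert E -> edge E) (ny : vert F -> edge F).
Variables (s : pred (vert E)) (t : pred (vert F)).
Hypotheses (skE : skeleton nx s) (skF : skeleton ny t).
Local Notation sg := (succ nx).
Local Notation ta := (succ ny).

(** The representatives in [F] absorb the shifts: [u i] lies [al i] steps before [vF i], with [al i]
    congruent to [a i], and the index of [w' j] is that of [w j] plus [b j], modulo the cycle
    lengths. The equivariant bijection matching [vE i] with [u i] and [w j] with [w' j] then
    preserves orbit sums. *)
Lemma sse_of_approx (ixE : vert E -> nat) (ixF : vert F -> nat) :
  vertex_indexing ixE -> vertex_indexing ixF -> graph_approx ixE ixF ->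
  strong_shift_equiv (adjacency E) (adjacency F).
Proof.
move=> hE hF [m [n [CE [DE [CF [DF [vE [vF [a [b]]]]]]]]]].
case=> -[CEN DEN] [CFN DFN] vEF [sizeC sizeD] counts.
have sgI := sk_inj skE; have taI := sk_inj skF.
have ss := sk_s skE; have tt := sk_s skF.
have cCE i : is_cycle (CE i) by case: CEN => /(_ i)/andP[].
have cCF i : is_cycle (CF i) by case: CFN => /(_ i)/andP[].
have cDE j : is_cycle (DE j) by case: DEN => /(_ j)/andP[].
have cDF j : is_cycle (DF j) by case: DFN => /(_ j)/andP[].
have vEC i : vE i \in cycle_vertices (CE i) by case: (vEF i) => /trail_source_mem.
have vFC i : vF i \in cycle_vertices (CF i) by case: (vEF i) => _ /trail_source_mem.
have size_gt0 (G : graph) (c : seq (edge G)) : is_cycle c -> 0 < size c.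
  by case/and3P; rewrite lt0n size_eq0.
have /fin_all_exists[al alP] i :
    exists k : nat, (Posz k == a i %[mod Posz (size (CE i))])%Z.
  exact: nat_residue (size_gt0 _ _ (cCE i)).
have /fin_all_exists[u uP] i : exists u, iter (al i) ta u = vF i.
  have [h _ hK] := injF_bij (iter_inj (k := al i) taI).
  by exists (h (vF i)).
have uC i : u i \in cycle_vertices (CF i).
  rewrite -(fconnect_cycle_vertices skF _ (cCF i) (vFC i)) fconnect_sym //.
  by rewrite -(uP i) fconnect_iter.
have /fin_all_exists[w wD] j : exists w, w \in cycle_vertices (DE j).
  exact: cycle_vertex_exists (cDE j).
have /fin_all_exists[w' w'P] j : exists w', w' \in cycle_vertices (DF j) /\
    (Posz (ixF w') == (Posz (ixE (w j)) + b j)%R %[mod Posz (size (DE j))])%Z.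
  have [x xD] := cycle_vertex_exists (cDF j).
  have [k kP] := nat_residue (Posz (ixE (w j)) + b j - Posz (ixF x))%R
    (size_gt0 _ _ (cDE j)).
  exists (iter k ta x); split.
    by rewrite -(fconnect_cycle_vertices skF _ (cDF j) xD) fconnect_iter.
  apply: eqmod_dvd_int (index_iter skF k x hF) _ _.
    by rewrite (order_cycle_vertices skF (cDF j) xD) sizeD.
  move: kP; rewrite eqz_mod_dvd; congr (_ %| _)%Z; lia.
have w'D j : w' j \in cycle_vertices (DF j) by case: (w'P j).
pose r := sum_elim vE w; pose r' := sum_elim u w'.
have ord x : order sg (r x) = order ta (r' x).
  case: x => [i|j] /=.
    by rewrite (order_cycle_vertices skE (cCE i)) // (order_cycle_vertices skF (cCF i)).
  by rewrite (order_cycle_vertices skE (cDE j)) // (order_cycle_vertices skF (cDF j)).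
have st x : s (r x) = t (r' x).
  case: x => [i|j] /=.
    by rewrite (source_numbering_s skE CEN vEC) (source_numbering_s skF CFN uC).
  by rewrite (negPf (sink_numbering_s skE DEN wD _))
    (negPf (sink_numbering_s skF DFN w'D _)).
have [f [fB fr]] := equivariant_bijection sgI taI (sum_cover skE CEN DEN vEC wD)
  (sum_disjoint skE CEN DEN vEC wD) (sum_cover skF CFN DFN uC w'D)
  (sum_disjoint skF CFN DFN uC w'D) ord.
have fE v : f (sg v) = ta (f v).
  have [x [k ->]] := sum_cover skE CEN DEN vEC wD v.
  by rewrite -[sg _]/(iter k.+1 sg _) !fr.
have ft v : t (f v) = s v.
  have [x [k ->]] := sum_cover skE CEN DEN vEC wD v.
  by rewrite fr !iter_invariant // st.
have Xs := transit_supported skE; have Yt := transit_supported skF.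
rewrite (adjacencyE skE) (adjacencyE skF).
apply: sse_trans (sse_ese (ese_relabel _ fB fE)).
have fYs : supported s (fun y1 y2 => transit ny (f y1) (f y2)).
  by move=> y1 y2 ny12; rewrite Yt // !ft.
apply: (sse_of_orbit_sum sgI ss Xs fYs) => -[y1 y2].
have [y12|ny12] := boolP (s y1 && ~~ s y2); last first.
  rewrite /orbit_sum !big1 // => y /iter_findex; rewrite iter_diag => <- /=.
    by apply: fYs; rewrite !(iter_invariant _ _ ss).
  by apply: Xs; rewrite !(iter_invariant _ _ ss).
case/andP: y12 => sy1 sy2.
have [i [k1 y1E]] := source_cover skE CEN vEC sy1.
have [k yk] : exists k, iter k sg y1 = vE i.
  exists (findex sg y1 (vE i)); apply: iter_findex.
  by rewrite fconnect_sym // y1E fconnect_iter.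
have [|j [l yl]] := sink_cover skE DEN wD (v := iter k sg y2).
  by rewrite iter_invariant.
(* Every orbit of source-sink pairs contains a pair [(vE i, iter l sg (w j))], whose orbit sum is a
   trail count. *)
rewrite -!(orbit_sum_iter _ k y1) // yk yl (orbit_sum_relabel _ _ fB fE) /=.
rewrite -[vE i]/(iter 0 sg (r (inl i))) -[w j]/(r (inr j)) !fr /=.
rewrite -[RHS](orbit_sum_iter _ (al i)) // uP -iterD.
set d := Posz (gcdn (size (CE i)) (size (DE j))).
rewrite -(@trail_count_orbit_sum _ _ _ skE ixE (CE i) (DE j) (vE i) _
  (Posz (ixE (w j) + l))) //.
- rewrite counts.
  apply: (trail_count_orbit_sum skF hF (cCF i) (cDF j) (vFC i)).
  + by rewrite -(fconnect_cycle_vertices skF _ (cDF j) (w'D j)) fconnect_iter.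
  + exact: (source_numbering_s skF CFN vFC i).
  + by rewrite iter_invariant // (sink_numbering_s skF DFN w'D).
  + by move=> y z; apply: (trail_source_transit skF (cCF i)); case: (vEF i).
  rewrite -sizeC -sizeD.
  apply: eqmod_dvd_int (index_iter skF _ _ hF) _ _.
    by rewrite (order_cycle_vertices skF (cDF j) (w'D j)) -sizeD dvdn_gcdr.
  have /dvdz_trans dC : (d %| Posz (size (CE i)))%Z by rewrite dvdzE /= dvdn_gcdl.
  have /dvdz_trans dD : (d %| Posz (size (DE j)))%Z by rewrite dvdzE /= dvdn_gcdr.
  move: (alP i); rewrite eqz_mod_dvd => /dC h1.
  case: (w'P j) => _; rewrite eqz_mod_dvd => /dD h2.
  (* The congruences for [a i] and [b j], known modulo the two cycle lengths, are added modulo their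
     gcd. *)
  have := GRing.rpredD h1 h2; congr (_ %| _)%Z; lia.
- by rewrite -(fconnect_cycle_vertices skE _ (cDE j) (wD j)) fconnect_iter.
- exact: (source_numbering_s skE CEN vEC i).
- by rewrite iter_invariant // (sink_numbering_s skE DEN wD).
- by move=> y z; apply: (trail_source_transit skE (cCE i)); case: (vEF i).
apply: eqmod_dvd_int (index_iter skE _ _ hE) _ _.
  by rewrite (order_cycle_vertices skE (cDE j) (wD j)) dvdn_gcdr.
by rewrite GRing.subrr dvdz0.
Qed.

End Backward.

Theorem theorem3p10 (E F : graph) (ixE : vert E -> nat) (ixF : vert F -> nat) :
  gk_dim3 E -> normal_form E -> vertex_indexing ixE ->
  gk_dim3 F -> normal_form F -> vertex_indexing ixF ->
  strong_shift_equiv (adjacency E) (adjacency F) <-> graph_approx ixE ixF.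
Proof.
move=> EG EN hE FG FN hF.
have [nx [s skE]] := skeleton_exists EG EN.
have [ny [t skF]] := skeleton_exists FG FN.
split; first exact: (approx_of_sse skE skF EN FN hE hF).
exact: (sse_of_approx skE skF hE hF).
Qed.
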